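(* There is a smooth function $\Omega$ with mean zero on the unit sphere in $\mathbb{C}^n$ such that, for the kernel $$K(z,t)=\frac{\Omega(z)}{|z|^{2n}}\,\frac{1}{|z|^2+it},\qquad (z,t)\in\mathbb{H}^n=\mathbb{C}^n\times\mathbb{R},$$ there is no operator $T$ having kernel $K$ that is bounded from $H^1(\mathbb{H}^n)$ to $L^1(\mathbb{H}^n)$.
   Context: $\mathbb{H}^n=\mathbb{C}^n\times\mathbb{R}$ is the Heisenberg group with law $(\zeta,t)\circ(\eta,s)=(\zeta+\eta,t+s+2\operatorname{Im}(\zeta\cdot\overline\eta))$, inverse $(\eta,s)^{-1}=(-\eta,-s)$, and Lebesgue measure. $\Omega$ is extended to $\mathbb{C}^n\setminus\{0\}$ as a function homogeneous of degree $0$. An operator $T$ has kernel $K$ if it acts by $Tf(\zeta,t)=\int_{\mathbb{H}^n}K((\zeta,t)\circ(\eta,s)^{-1})f(\eta,s)\,d\eta\,ds$ (as a singular integral). $H^1(\mathbb{H}^n)$ is the classical one-parameter (Folland–Stein) Hardy space of $\mathbb{H}^n$ associated with the automorphic dilations $(z,t)\mapsto(\lambda z,\lambda^2t)$. *)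

(* Defs.v *)
From HB Require Import structures.
From mathcomp Require Import all_boot all_order all_algebra.
From mathcomp Require Import all_classical all_reals all_analysis.
From mathcomp Require Import complex.

Set Implicit Arguments.
Unset Strict Implicit.
Unset Printing Implicit Defensive.

Import Order.TTheory GRing.Theory Num.Theory.
Import numFieldNormedType.Exports.

Local Open Scope complex_scope.
Local Open Scope classical_set_scope.
Local Open Scope ring_scope.

Definition rV_display : measure_display. Proof. exact: default_measure_display. Qed.

(* The product sigma-algebra, generated by the coordinates; it is the Borel
   sigma-algebra of R^m. *)
Section measurable_rV.
Context (R : realType) (m : nat).

Definition rV_coord (i : 'I_m) (v : 'rV[R]_m) : R := v ord0 i.

Let rV_set0 : g_sigma_preimage rV_coord set0.
Proof. exact: sigma_algebra0. Qed.

Let rV_setC A : g_sigma_preimage rV_coord A -> g_sigma_preimage rV_coord (~` A).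
Proof. exact: sigma_algebraC. Qed.

Let rV_bigcup (F : (set 'rV[R]_m)^nat) :
  (forall i, g_sigma_preimage rV_coord (F i)) ->
  g_sigma_preimage rV_coord (\bigcup_i (F i)).
Proof. exact: sigma_algebra_bigcup. Qed.

HB.instance Definition _ := @isMeasurable.Build rV_display
  'rV[R]_m (g_sigma_preimage rV_coord) rV_set0 rV_setC rV_bigcup.

Lemma measurable_rV_coord (i : 'I_m) : measurable_fun setT (rV_coord i).
Proof.
move=> _ Y mY; rewrite setTI; apply: sub_sigma_algebra => /=.
rewrite -bigcup_seq/=; exists i => /=; first by rewrite mem_index_enum.
by exists Y => //; rewrite setTI.
Qed.

Lemma measurable_fun_rV d (T : measurableType d) (f : T -> 'rV[R]_m) :
  (forall i, measurable_fun setT (rV_coord i \o f)) -> measurable_fun setT f.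
Proof.
move=> mf _ Y; rewrite setTI.
suff: g_sigma_preimage rV_coord `<=` [set A | measurable (f @^-1` A)] by exact.
apply: smallest_sub.
  split => /=.
  - by rewrite preimage_set0.
  - by move=> A mA; rewrite setTD preimage_setC; exact: measurableC.
  - by move=> F mF; rewrite preimage_bigcup; exact: bigcup_measurable.
move=> A; rewrite -bigcup_seq/= => -[i _ [B mB <-]].
by rewrite setTI -comp_preimage -[X in measurable X]setTI; exact: mf.
Qed.

End measurable_rV.

Lemma sigma_finite_product d1 d2 (T1 : measurableType d1)
    (T2 : measurableType d2) (R : realType)
    (m1 : {sigma_finite_measure set T1 -> \bar R})
    (m2 : {sigma_finite_measure set T2 -> \bar R}) :
  sigma_finite setT (m1 \x m2)%E.
Proof.
have /sigma_finiteP[F [TF ndF Foo]] := sigma_finiteT m1.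
have /sigma_finiteP[G [TG ndG Goo]] := sigma_finiteT m2.
exists (fun n => F n `*` G n).
  rewrite -setXTT TF TG predeqE => -[x y]; split.
    move=> [/= [n _ Fnx] [k _ Gky]]; exists (maxn n k) => //; split.
    - by move: x Fnx; exact/subsetPset/ndF/leq_maxl.
    - by move: y Gky; exact/subsetPset/ndG/leq_maxr.
  by move=> [n _ []/= ? ?]; split; exists n.
move=> k; have [? ?] := Foo k; have [? ?] := Goo k.
split; first exact: measurableX.
by rewrite product_measure1E// lte_mul_pinfty// ge0_fin_numE.
Qed.

Section lebesgue_rV.
Context (R : realType).

Definition rV_cons m (p : measurableTypeR R * 'rV[R]_m) : 'rV[R]_m.+1 :=
  row_mx (const_mx p.1 : 'rV[R]_1) p.2.

Definition rV_uncons m (v : 'rV[R]_m.+1) : measurableTypeR R * 'rV[R]_m :=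
  (v ord0 ord0, @rsubmx _ 1 1 m v).

Lemma rV_consK m : cancel (@rV_cons m) (@rV_uncons m).
Proof.
case=> a v; rewrite /rV_uncons /rV_cons /= row_mxKr.
by congr pair; rewrite mxE; case: fintype.splitP => // j _; rewrite mxE.
Qed.

Lemma measurable_rV_cons m : measurable_fun setT (@rV_cons m).
Proof.
apply: measurable_fun_rV => i.
rewrite (_ : _ \o _ = fun p : measurableTypeR R * 'rV[R]_m =>
   match @fintype.split 1 m i with
   | inl _ => p.1 | inr k => rV_coord k p.2 end); last first.
  apply/funext => p /=; rewrite /rV_coord /rV_cons mxE.
  by case: fintype.split => // j; rewrite mxE.
case: fintype.split => [_|k]; first exact: measurable_fst.
exact: (measurableT_comp (measurable_rV_coord k) measurable_snd).
Qed.

Lemma measurable_rV_uncons m : measurable_fun setT (@rV_uncons m).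
Proof.
apply/measurable_fun_pairP; split; first exact: (measurable_rV_coord ord0).
apply: measurable_fun_rV => i /=.
rewrite (_ : _ \o _ = rV_coord (@rshift 1 m i)); last first.
  by apply/funext => v /=; rewrite /rV_coord mxE.
exact: measurable_rV_coord.
Qed.

Section rV_measure_cons.
Context m (mu : {sigma_finite_measure set 'rV[R]_m -> \bar R}).

Definition rV_measure_cons : set 'rV[R]_m.+1 -> \bar R :=
  pushforward ((@lebesgue_measure R) \x mu)%E (@rV_cons m).

Let rV_measure_cons0 : rV_measure_cons set0 = 0%E.
Proof. by rewrite /rV_measure_cons /pushforward preimage_set0 measure0. Qed.

Let rV_measure_cons_ge0 A : (0 <= rV_measure_cons A)%E.
Proof. by rewrite /rV_measure_cons /pushforward measure_ge0. Qed.

Let rV_measure_cons_sigma_additive : semi_sigma_additive rV_measure_cons.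
Proof.
have mpre A : measurable A -> measurable (@rV_cons m @^-1` A).
  by move=> mA; rewrite -[X in measurable X]setTI; exact: measurable_rV_cons.
move=> F mF tF mUF; rewrite /rV_measure_cons /pushforward preimage_bigcup.
apply: measure_semi_sigma_additive.
- by move=> k; exact: mpre.
- apply/trivIsetP => /= i j _ _ ij; rewrite -preimage_setI.
  by move/trivIsetP : tF => /(_ _ _ _ _ ij) ->//; rewrite preimage_set0.
- by rewrite -preimage_bigcup; exact: mpre.
Qed.

HB.instance Definition _ := isMeasure.Build _ _ _ rV_measure_cons
  rV_measure_cons0 rV_measure_cons_ge0 rV_measure_cons_sigma_additive.

Let rV_measure_cons_sigma_finite : sigma_finite setT rV_measure_cons.
Proof.
have [F FT mF] := sigma_finite_product (@lebesgue_measure R) mu.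
exists (fun k => @rV_uncons m @^-1` F k).
  by rewrite -preimage_bigcup -FT preimage_setT.
move=> k; have [mFk Fk] := mF k; split.
  by rewrite -[X in measurable X]setTI; exact: measurable_rV_uncons.
rewrite /rV_measure_cons /pushforward -comp_preimage.
by rewrite (_ : _ \o _ = id)//; apply/funext => p; exact: rV_consK.
Qed.

HB.instance Definition _ := Measure_isSigmaFinite.Build _ _ _
  rV_measure_cons rV_measure_cons_sigma_finite.

End rV_measure_cons.

(* Lebesgue measure on R^0 is the unit mass, and on R^(m+1) it is the product
   of the Lebesgue measures on R and R^m. *)
Fixpoint lebesgue_rV (m : nat) : {sigma_finite_measure set 'rV[R]_m -> \bar R} :=
  match m with
  | 0 => dirac (0 : 'rV[R]_0)
  | m'.+1 => rV_measure_cons (lebesgue_rV m')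
  end.

End lebesgue_rV.

Section complex_integration.
Context d (T : measurableType d) (R : realType).
Variable mu : {measure set T -> \bar R}.

Definition cintegral (D : set T) (f : T -> R[i]) : R[i] :=
  Rintegral mu D (fun x => complex.Re (f x)) +i*
  Rintegral mu D (fun x => complex.Im (f x)).

Definition L1 (f : T -> R[i]) : Prop :=
  mu.-integrable setT (fun x => (complex.Re (f x))%:E) /\
  mu.-integrable setT (fun x => (complex.Im (f x))%:E).

Definition L1norm (f : T -> R[i]) : \bar R :=
  (\int[mu]_x (Normc.normc (f x))%:E)%E.

End complex_integration.

Section smooth.
Context (R : realType) (V : normedModType R).

Definition iter_derive (vs : seq V) (f : V -> R) : V -> R :=
  foldr (fun v g => 'D_v g) f vs.

Definition smooth_on (U : set V) (f : V -> R) : Prop :=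
  forall (vs : seq V) (x : V), U x ->
    {for x, continuous (iter_derive vs f)} /\
    forall v, derivable (iter_derive vs f) x v.

Definition csmooth_on (U : set V) (f : V -> R[i]) : Prop :=
  smooth_on U (fun x => complex.Re (f x)) /\
  smooth_on U (fun x => complex.Im (f x)).

End smooth.

(* The real vector (x, y) in R^(n+n) stands for the point x + i y of C^n. *)
Notation Cn R n := 'rV[R]_(n + n).

Section Cn.
Context (R : realType) (n : nat).

Definition Ccoord (z : Cn R n) (j : 'I_n) : R[i] :=
  z ord0 (lshift n j) +i* z ord0 (rshift n j).

Definition hdot (z w : Cn R n) : R[i] :=
  \sum_(j < n) Ccoord z j * conjc (Ccoord w j).

Definition enorm (z : Cn R n) : R :=
  Num.sqrt (\sum_(j < n) Normc.normc (Ccoord z j) ^+ 2).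

(* The extension, homogeneous of degree 0, of a function on the unit sphere;
   only the restriction of Omega to the sphere matters, and the value of the
   extension at 0 is irrelevant. *)
Definition hom0 (Omega : Cn R n -> R[i]) (z : Cn R n) : R[i] :=
  Omega ((enorm z)^-1 *: z).

Definition smooth_on_sphere (Omega : Cn R n -> R[i]) : Prop :=
  csmooth_on [set z | z != 0] (hom0 Omega).

(* The surface measure of the sphere S in R^N, here N = 2n, is given by
   sigma(A) = N * |{r w : 0 < r <= 1, w in A}|, so that the integral of Omega
   over S is N times the integral of Omega(z/|z|) over the punctured ball. *)
Definition sphere_integral (Omega : Cn R n -> R[i]) : R[i] :=
  (n + n)%:R *
  cintegral (lebesgue_rV R (n + n)) [set z | 0 < enorm z <= 1] (hom0 Omega).

End Cn.

(* measurableTypeR R is R with its Borel sigma-algebra. *)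
Notation heis R n := (Cn R n * measurableTypeR R)%type.

Section heisenberg.
Context (R : realType) (n : nat).

Definition hmul (x y : heis R n) : heis R n :=
  (x.1 + y.1, x.2 + y.2 + 2 * complex.Im (hdot x.1 y.1)).

Definition hinv (x : heis R n) : heis R n := (- x.1, - x.2).

Definition hdil (r : R) (x : heis R n) : heis R n := (r *: x.1, r ^+ 2 * x.2).

Definition hdim : nat := (n + n + 2)%N.

(* The Koranyi norm, homogeneous of degree 1 under hdil. *)
Definition hnorm (x : heis R n) : R :=
  Num.sqrt (Num.sqrt (enorm x.1 ^+ 4 + x.2 ^+ 2)).

Definition hmeasure : set (heis R n) -> \bar R :=
  (lebesgue_rV R (n + n) \x (@lebesgue_measure R))%E.

HB.instance Definition _ := Measure.on hmeasure.

HB.instance Definition _ := Measure_isSigmaFinite.Build _ _ _ hmeasure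
  (sigma_finite_product (lebesgue_rV R (n + n)) (@lebesgue_measure R)).

Definition hconv (g f : heis R n -> R[i]) (x : heis R n) : R[i] :=
  cintegral hmeasure setT (fun y => g (hmul x (hinv y)) * f y).

Definition schwartz (phi : heis R n -> R) : Prop :=
  smooth_on setT phi /\
  forall (k : nat) (vs : seq (heis R n)), exists C : R,
    forall x, (1 + hnorm x) ^+ k * `|iter_derive vs phi x| <= C.

Definition cschwartz (phi : heis R n -> R[i]) : Prop :=
  schwartz (fun x => complex.Re (phi x)) /\
  schwartz (fun x => complex.Im (phi x)).

(* The left-invariant derivative along v; one-parameter subgroups of the
   group are s |-> s v. *)
Definition left_inv_derive (v : heis R n) (phi : heis R n -> R) : heis R n -> R :=
  fun x => derive1 (fun s : R => phi (hmul x (s *: v))) 0.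

Definition cleft_inv_derive (v : heis R n) (phi : heis R n -> R[i])
    (x : heis R n) : R[i] :=
  left_inv_derive v (fun y => complex.Re (phi y)) x +i*
  left_inv_derive v (fun y => complex.Im (phi y)) x.

(* The standard basis of the Lie algebra; None is the central direction. *)
Definition hbasis (j : option 'I_(n + n)) : heis R n :=
  if j is Some k then (delta_mx ord0 k, 0) else (0, 1).

(* The condition ||phi||_(N) <= 1 for the Folland-Stein seminorm
     ||phi||_(N) = sup_(|I| <= N, x) (1 + |x|)^((N + 1) (Q + 1)) |X^I phi(x)|
   of order N = 1, the order which defines H^p for p = 1. *)
Definition FS_normalized (phi : heis R n -> R[i]) : Prop :=
  let w x := (1 + hnorm x) ^+ (2 * (hdim + 1)) in
  [/\ cschwartz phi,
      forall x, w x * Normc.normc (phi x) <= 1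
    & forall j x, w x * Normc.normc (cleft_inv_derive (hbasis j) phi x) <= 1].

Definition hdilate (t : R) (phi : heis R n -> R[i]) : heis R n -> R[i] :=
  fun x => ((t ^+ hdim)^-1)%:C * phi (hdil t^-1 x).

(* The nontangential grand maximal function. Operators acting by
   f |-> hconv K f commute with right translations, so sides are chosen
   accordingly: hconv phi_t f and the right-invariant distance |y x^-1|.
   Inversion x |-> x^-1 exchanges this with the mirror convention, which
   uses f * phi_t, |x^-1 y| and right-invariant derivatives. *)
Definition grand_maximal (f : heis R n -> R[i]) (x : heis R n) : \bar R :=
  ereal_sup [set e : \bar R | exists (phi : heis R n -> R[i]) (t : R) (y : heis R n),
    [/\ FS_normalized phi, 0 < t, hnorm (hmul y (hinv x)) < t
      & e = (Normc.normc (hconv (hdilate t phi) f y))%:E]].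

Definition H1norm (f : heis R n -> R[i]) : \bar R :=
  (\int[hmeasure]_x grand_maximal f x)%E.

(* Distributions whose grand maximal function is integrable are integrable
   functions, so H^1 is defined inside L^1. *)
Definition H1 (f : heis R n -> R[i]) : Prop :=
  L1 hmeasure f /\ (H1norm f < +oo)%E.

(* A linear operator from H^1 to L^1, acting on functions modulo null sets. *)
Definition bounded_H1_L1 (T : (heis R n -> R[i]) -> heis R n -> R[i]) : Prop :=
  (forall (a : R[i]) f g, H1 f -> H1 g ->
     {ae hmeasure, forall x, T (fun y => a * f y + g y) x = a * T f x + T g x}) /\
  exists C : R, forall f, H1 f ->
    L1 hmeasure (T f) /\ (L1norm hmeasure (T f) <= C%:E * H1norm f)%E.

(* T is a singular integral operator with kernel K, for a kernel K that is
   singular only at the points (0, t): T f is given by the integral of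
   K(x y^-1) f(y) at the points x for which no singularity of
   y |-> K(x y^-1) meets the support of f, that is over an open set U of C^n
   such that f = 0 on U x R. This holds in particular for the principal
   value, i.e. the limit of the integrals over |x.1 - y.1| > eps. *)
Definition has_kernel (T : (heis R n -> R[i]) -> heis R n -> R[i])
    (K : heis R n -> R[i]) : Prop :=
  forall (f : heis R n -> R[i]) (U : set (Cn R n)), H1 f -> open U ->
    {ae hmeasure, forall y, U y.1 -> f y = 0} ->
    {ae hmeasure, forall x, U x.1 -> T f x = hconv K f x}.

Definition flag_kernel (Omega : Cn R n -> R[i]) (x : heis R n) : R[i] :=
  hom0 Omega x.1 / (enorm x.1 ^+ (2 * n))%:C *
  (enorm x.1 ^+ 2 +i* x.2)^-1.

End heisenberg.

(* Main.v *)
(* Let Omega(z) = Re(z_1) Im(z_1) on the sphere and k(z) = Omega(z) / |z|^(2n),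
   and let f be the difference of the indicators of two boxes exchanged by the
   reflection rho of the first real coordinate.

   The function f is a multiple of an atom, hence in H^1. For |x| bounded,
   phi_t * f is bounded because phi_t is bounded in L^1. For |x| large,
   2 (phi_t * f)(y) is the integral of
   (phi_t(y w^-1) - phi_t(y (rho w)^-1)) f(w), and (rho w)^-1 is w^-1 times a
   bounded horizontal step times a bounded central step, so the mean value
   theorem gives the integrable decay |x|^-(Q+1).

   As t tends to infinity, (K * f)(z, t) behaves like 1 / (i t) times the
   Euclidean singular integral of the t-marginal of f with kernel k. This
   singular integral does not vanish, so K * f is not integrable in t, and f
   alone refutes boundedness. No asymptotic analysis is needed: for z in a
   suitable box separating the two halves of f, k(z - eta) f(eta, s) has a
   constant sign, so no cancellation occurs in Im (K * f)(z, t), which is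
   bounded below by c / t. *)
Require Import Defs.
From HB Require Import structures.
From mathcomp Require Import all_boot all_order all_algebra.
From mathcomp Require Import all_classical all_reals all_analysis.
From mathcomp Require Import complex.
From mathcomp Require Import measurable_realfun.
From mathcomp Require Import ring lra.

Set Implicit Arguments.
Unset Strict Implicit.
Unset Printing Implicit Defensive.

Import Order.TTheory GRing.Theory Num.Theory.
Import numFieldNormedType.Exports.

Local Open Scope complex_scope.
Local Open Scope classical_set_scope.
Local Open Scope ring_scope.

(** * Smoothness of rational functions off the origin *)

Section rational_functions.
Context (R : realType) (m : nat).
Local Notation V := 'rV[R]_m.

(** A class closed under directional derivatives off the origin. Inverses require a denominator that
    can vanish only at 0, as does [|z|^2] in [hom0 omega]. *)
Inductive rational_fun : (V -> R) -> Prop :=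
| rational_cst c : rational_fun (fun=> c)
| rational_coord i : rational_fun (fun z => z ord0 i)
| rational_add f g : rational_fun f -> rational_fun g ->
    rational_fun (fun z => f z + g z)
| rational_mul f g : rational_fun f -> rational_fun g ->
    rational_fun (fun z => f z * g z)
| rational_inv f : rational_fun f -> (forall z, z != 0 -> f z != 0) ->
    rational_fun (fun z => (f z)^-1).

Lemma rational_sum (I : Type) (s : seq I) (f : I -> V -> R) :
  (forall i, rational_fun (f i)) -> rational_fun (fun z => \sum_(i <- s) f i z).
Proof.
move=> rf; elim: s => [|i s IH].
  rewrite (_ : (fun _ => _) = fun=> 0); first exact: rational_cst.
  by apply/funext => z; rewrite big_nil.
rewrite (_ : (fun _ => _) = fun z => f i z + \sum_(i <- s) f i z).
  exact: rational_add.
by apply/funext => z; rewrite big_cons.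
Qed.

Lemma rational_differentiable f z : rational_fun f -> z != 0 ->
  differentiable f z.
Proof.
move=> rf z0; elim: rf => {f} [c|i|f g _ IHf _ IHg|f g _ IHf _ IHg|f _ IHf fn0].
- exact: differentiable_cst.
- exact: differentiable_coord.
- exact: (differentiableD IHf IHg).
- exact: (differentiableM IHf IHg).
- exact: (differentiableV IHf (fn0 _ z0)).
Qed.

(** The sum, product and inverse rules stay in the class; they apply off 0, where all its members
    are differentiable. *)
Lemma rational_derive f v : rational_fun f ->
  exists2 g, rational_fun g & forall z, z != 0 -> 'D_v f z = g z.
Proof.
elim => {f} [c|i|f g rf [f' rf' Ef] rg [g' rg' Eg]
    |f g rf [f' rf' Ef] rg [g' rg' Eg]|f rf [f' rf' Ef] fn0].
- exists (fun=> 0); first exact: rational_cst.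
  by move=> z _; exact: derive_cst.
- exists (fun=> v ord0 i); first exact: rational_cst.
  move=> z z0; have /derive_mx := @derivable_id R V z v.
  by move/matrixP => /(_ ord0 i); rewrite mxE derive_id.
- exists (fun z => f' z + g' z); first exact: rational_add.
  move=> z z0; rewrite -Ef// -Eg//.
  by apply: deriveD; apply: diff_derivable; exact: rational_differentiable.
- exists (fun z => f z * g' z + g z * f' z).
    by apply: rational_add; exact: rational_mul.
  move=> z z0; rewrite -Ef// -Eg//.
  by apply: deriveM; apply: diff_derivable; exact: rational_differentiable.
- exists (fun z => -1 * ((f z)^-1 * (f z)^-1) * f' z).
    apply: rational_mul => //; apply: rational_mul; first exact: rational_cst.
    by apply: rational_mul; exact: rational_inv.
  move=> z z0; rewrite -Ef// mulN1r -invfM -expr2.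
  apply: deriveV; first exact: fn0.
  by apply: diff_derivable; exact: rational_differentiable.
Qed.

(** Off 0 every iterated derivative coincides with a rational function. The punctured space is open,
    so the coincidence holds near each point and passes to the next derivative and to continuity. *)
Lemma rational_smooth f : rational_fun f -> smooth_on [set z | z != 0] f.
Proof.
move=> rf vs x x0.
have o0 : open [set y : V | y != 0].
  rewrite (_ : [set y : V | y != 0] = ~` [set 0]); last first.
    by apply/seteqP; split => y /= /eqP.
  apply: closed_openC; apply: accessible_closed_set1.
  by apply: hausdorff_accessible; exact: norm_hausdorff.
have op (z : V) : z != 0 -> \forall y \near z, y != 0.
  by move=> z0; exact: (open_nbhs_nbhs (conj o0 z0)).
have [g rg Eg] : exists2 g, rational_fun g &
    forall z, z != 0 -> iter_derive vs f z = g z.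
  elim: vs => [|v vs [g rg Eg]]; first by exists f.
  have [g' rg' Eg'] := rational_derive v rg.
  exists g' => // z z0; rewrite -Eg'//=; apply: near_eq_derive.
  by apply: filterS (op _ z0) => y /Eg.
have gx : {near x, g =1 iter_derive vs f}.
  by apply: filterS (op _ x0) => y /Eg.
split => [|v].
  rewrite /prop_for /continuous_at (Eg x x0).
  have := differentiable_continuous (rational_differentiable rg x0).
  by apply: cvg_trans; exact: (near_eq_cvg gx).
apply: (near_eq_derivable gx).
by apply: diff_derivable; exact: rational_differentiable.
Qed.

End rational_functions.

(** * Integration *)

Import HBNNSimple.

Section integration.
Context d (T : measurableType d) (R : realType).
Variable mu : {measure set T -> \bar R}.

(* Measurability is not assumed in these comparisons: it is unknown for the
   grand maximal function. *)
Lemma ge0_le_integralT (f g : T -> \bar R) :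
  (forall x, 0 <= f x)%E -> (forall x, f x <= g x)%E ->
  (\int[mu]_x f x <= \int[mu]_x g x)%E.
Proof.
move=> f0 fg; rewrite !ge0_integralTE//; last first.
  by move=> x; exact: le_trans (f0 x) (fg x).
apply: ereal_sup_le => _ [h /= hf <-]; exists h => //= x.
exact: le_trans (hf x) (fg x).
Qed.

Lemma ge0_le_RintegralT (f : T -> R) (g : T -> \bar R) (B : R) :
  (forall x, 0 <= f x) -> (forall x, (f x)%:E <= g x)%E ->
  (\int[mu]_x g x <= B%:E)%E -> (\int[mu]_x (f x)%:E = (Rintegral mu setT f)%:E)%E.
Proof.
move=> f0 fg gB; rewrite fineK// ge0_fin_numE; last first.
  by apply: integral_ge0 => x _; rewrite lee_fin.
apply: le_lt_trans (ltry B); apply: le_trans gB; exact: ge0_le_integralT.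
Qed.

(** The positive and negative parts of [f] are both dominated by [g], so their integrals are real
    numbers in [[0, B]] and differ by at most [B]. *)
Lemma normr_RintegralT_le (f : T -> R) (g : T -> \bar R) (B : R) :
  (forall x, `|f x|%:E <= g x)%E -> (\int[mu]_x g x <= B%:E)%E ->
  `|Rintegral mu setT f| <= B.
Proof.
move=> fg gB; rewrite /Rintegral integralE.
have bnd (h : T -> \bar R) : (forall x, 0 <= h x)%E ->
    (forall x, h x <= `|f x|%:E)%E ->
    exists2 r, (\int[mu]_x h x = r%:E)%E & 0 <= r <= B.
  move=> h0 hf; have hB : (\int[mu]_x h x <= B%:E)%E.
    apply: le_trans gB; apply: ge0_le_integralT => // x.
    exact: le_trans (hf x) (fg x).
  have := @integral_ge0 _ _ _ mu setT h (fun x _ => h0 x).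
  move: hB; case: (\int[mu]_x _)%E => // r; rewrite !lee_fin => rB r0.
  by exists r => //; rewrite r0.
have [||a -> a0] := bnd ((EFin \o f)^\+%E) => //.
  move=> x; rewrite funeposE/= -EFin_max lee_fin ge_max normr_ge0 andbT.
  exact: ler_norm.
have [||b -> b0] := bnd ((EFin \o f)^\-%E) => //.
  move=> x; rewrite funenegE/= -EFin_max lee_fin ge_max normr_ge0 andbT.
  by rewrite -normrN; exact: ler_norm.
by rewrite -EFinB/= ler_norml; lra.
Qed.

(** Passes through the positive part of [f]. This serves the grand maximal function, a supremum
    whose sign is left open. *)
Lemma le_integralT (f g : T -> \bar R) :
  (forall x, 0 <= g x)%E -> (forall x, f x <= g x)%E ->
  (\int[mu]_x f x <= \int[mu]_x g x)%E.
Proof.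
move=> g0 fg; rewrite integralE; apply: (@le_trans _ _ (\int[mu]_x f^\+ x)%E).
  by rewrite -[leRHS]sube0; apply: leeB => //; exact: integral_ge0.
apply: ge0_le_integralT => x; first exact: funepos_ge0.
by rewrite funeposE ge_max fg g0.
Qed.

Definition measure_preserving (phi : T -> T) :=
  measurable_fun setT phi /\
  forall A, measurable A -> mu (phi @^-1` A) = mu A.

Lemma ge0_integral_preserving phi (f : T -> \bar R) : measure_preserving phi ->
  measurable_fun setT f -> (forall x, 0 <= f x)%E ->
  (\int[mu]_x f (phi x) = \int[mu]_x f x)%E.
Proof.
move=> [mphi phiE] mf f0.
have := @ge0_integral_pushforward _ _ _ _ _ _ mphi mu setT f measurableT mf.
rewrite preimage_setT => <-; last by move=> x _; exact: f0.
pose M := isMeasurableFun.Build _ _ _ _ _ mphi.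
pose P : {mfun T >-> T} := HB.pack phi M.
apply: (@eq_measure_integral _ _ _ _ mu (pushforward mu P)).
by move=> A mA _; exact: phiE.
Qed.

Lemma integral_preserving phi (f : T -> R) : measure_preserving phi ->
  measurable_fun setT f ->
  (\int[mu]_x (f (phi x))%:E = \int[mu]_x (f x)%:E)%E.
Proof.
move=> phiP mf; rewrite integralE [RHS]integralE.
have mF : measurable_fun setT (EFin \o f) by exact/measurable_EFinP.
congr (_ - _)%E.
- have <- := ge0_integral_preserving phiP (measurable_funepos mF) (funepos_ge0 _).
  by apply: eq_integral => x _; rewrite !funeposE.
- have <- := ge0_integral_preserving phiP (measurable_funeneg mF) (funeneg_ge0 _).
  by apply: eq_integral => x _; rewrite !funenegE.
Qed.

(** Composition with [phi] exchanges the positive and negative parts of [f], so these have the same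
    integral. *)
Lemma Rintegral_odd phi (f : T -> R) : measure_preserving phi ->
  measurable_fun setT f -> (forall x, f (phi x) = - f x) ->
  Rintegral mu setT f = 0.
Proof.
move=> phiP mf fN; have mF : measurable_fun setT (EFin \o f).
  exact/measurable_EFinP.
rewrite /Rintegral integralE.
have /= <- := ge0_integral_preserving phiP (measurable_funepos mF) (funepos_ge0 _).
rewrite (_ : (fun x => _) = (EFin \o f)^\-%E); last first.
  by apply/funext => x; rewrite funeposE funenegE/= fN EFinN.
(* If the common value is [+oo], the difference is [-oo] by convention and [fine] sends it to 0. *)
by case: (\int[mu]_x _)%E => [r| |]//; rewrite -EFinB/= subrr.
Qed.

End integration.

Section product_preserving.
Context d1 d2 (T1 : measurableType d1) (T2 : measurableType d2) (R : realType).
Variables (m1 : {sigma_finite_measure set T1 -> \bar R})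
  (m2 : {sigma_finite_measure set T2 -> \bar R}).

(** The pushforward agrees with the product measure on rectangles, which determines it by
    sigma-finiteness. *)
Lemma measure_preserving_fst phi : measure_preserving m1 phi ->
  measure_preserving (m1 \x m2)%E (fun p => (phi p.1, p.2)).
Proof.
move=> [mphi phiE].
pose Phi (p : T1 * T2) := (phi p.1, p.2).
have mPhi : measurable_fun setT Phi.
  apply/measurable_fun_pairP; split; last exact: measurable_snd.
  exact: measurableT_comp mphi measurable_fst.
split=> // A mA.
pose M := isMeasurableFun.Build _ _ _ _ _ mPhi.
pose P : {mfun (T1 * T2)%type >-> (T1 * T2)%type} := HB.pack Phi M.
symmetry; apply: (@product_measure_unique _ _ _ _ _ m1 m2
   (pushforward (m1 \x m2)%E P)) mA => {}A B mA mB.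
transitivity ((m1 \x m2)%E ((phi @^-1` A) `*` B)); first by [].
rewrite product_measure1E// ?phiE//.
by rewrite -[X in measurable X]setTI; exact: mphi.
Qed.
End product_preserving.

(** * Boxes, reflections and sheared strips under Lebesgue measure *)

Section lebesgue_rV_lemmas.
Context (R : realType).

Lemma rV_cons_ord0 m (p : measurableTypeR R * 'rV[R]_m) :
  rV_cons p ord0 ord0 = p.1.
Proof. by have /(congr1 fst) := rV_consK p. Qed.

Lemma rV_cons_lift m (p : measurableTypeR R * 'rV[R]_m) j :
  rV_cons p ord0 (lift ord0 j) = p.2 ord0 j.
Proof.
have /(congr1 snd) <- := rV_consK p; rewrite [RHS]mxE; congr (fun_of_matrix _ _ _).
exact: val_inj.
Qed.

Lemma measurable_rV_forall m (P : 'I_m -> set R) :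
  (forall i, measurable (P i)) ->
  measurable [set v : 'rV[R]_m | forall i, P i (v ord0 i)].
Proof.
move=> mP; rewrite (_ : mkset _ = \bigcap_(i in setT) (@rV_coord R m i @^-1` P i)).
  apply: fin_bigcap_measurable => [|i _]; first exact: finite_finset.
  by rewrite -[X in measurable X]setTI; exact: measurable_rV_coord.
by apply/seteqP; split => v /= vP i; [move=> _|]; exact: vP.
Qed.

Lemma measurable_rV_box m (a b : 'I_m -> R) :
  measurable [set v : 'rV[R]_m | forall i, a i <= v ord0 i <= b i].
Proof.
pose I i : set R := `[a i, b i]%classic.
rewrite (_ : mkset _ = [set v : 'rV[R]_m | forall i, I i (v ord0 i)]).
  by apply: measurable_rV_forall => i; exact: measurable_itv.
by apply/seteqP; split => v vB i; have := vB i; rewrite /I/= in_itv.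
Qed.

Lemma lebesgue_measure_cc (a b : R) : a <= b ->
  lebesgue_measure (`[a, b]%classic : set R) = (b - a)%:E.
Proof.
rewrite le_eqVlt => /predU1P[->|ab].
  by rewrite set_itv1 lebesgue_measure_set1 subrr.
by rewrite lebesgue_measure_itv/= lte_fin ab.
Qed.

Lemma lebesgue_rV_box m (a b : 'I_m -> R) : (forall i, a i <= b i) ->
  lebesgue_rV R m [set v | forall i, a i <= v ord0 i <= b i] =
  (\prod_i (b i - a i))%:E.
Proof.
elim: m a b => [a b _|m IH a b ab].
  rewrite big_ord0 /= diracE mem_set//= => i; by case: i.
transitivity ((lebesgue_measure \x lebesgue_rV R m)%E
  (`[a ord0, b ord0]%classic `*`
   [set v : 'rV[R]_m | forall i, a (lift ord0 i) <= v ord0 i <= b (lift ord0 i)])).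
  rewrite /= /rV_measure_cons /pushforward; congr product_measure1.
  apply/seteqP; split => -[x v] /=.
    move=> H; split => [|i]; first by have := H ord0; rewrite rV_cons_ord0/= in_itv.
    by have := H (lift ord0 i); rewrite rV_cons_lift.
  move=> [H0 H] i; have [j ->|->] := fintype.unliftP ord0 i.
    rewrite rV_cons_lift; exact: H.
  by rewrite rV_cons_ord0; move: H0; rewrite in_itv.
rewrite product_measure1E//; last exact: measurable_rV_box.
rewrite IH// big_ord_recl EFinM; congr (_ * _)%E.
exact: lebesgue_measure_cc.
Qed.

(** On C^n the first coordinate is the real part of z_1, so this is the map z_1 |-> - conj z_1. *)
Definition rV_flip m (v : 'rV[R]_m.+1) : 'rV[R]_m.+1 :=
  \row_j (if j == ord0 then - v ord0 j else v ord0 j).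

Lemma rV_flipK m : involutive (@rV_flip m).
Proof.
by move=> v; apply/rowP => j; rewrite !mxE; case: eqP; rewrite ?opprK.
Qed.

Lemma measurable_rV_flip m : measurable_fun setT (@rV_flip m).
Proof.
apply: measurable_fun_rV => i.
rewrite (_ : _ \o _ = fun v : 'rV[R]_m.+1 =>
  if i == ord0 then - v ord0 i else v ord0 i).
  case: eqP => _; last exact: measurable_rV_coord.
  exact: (measurable_funN (measurable_rV_coord i)).
by apply/funext => v /=; rewrite /rV_coord mxE.
Qed.

(** Through [rV_cons] the flip becomes negation on the first factor, which preserves Lebesgue
    measure on R. *)
Lemma rV_flip_preserving m : measure_preserving (lebesgue_rV R m.+1) (@rV_flip m).
Proof.
split=> [|A mA]; first exact: measurable_rV_flip.
have opp : measure_preserving (@lebesgue_measure R)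
    (-%R : measurableTypeR R -> measurableTypeR R).
  split => [|B mB].
    exact: oppr_measurable.
  exact: lebesgue_measureN.
have [_ /(_ (@rV_cons R m @^-1` A)) H] := measure_preserving_fst (lebesgue_rV R m) opp.
pose neg (p : measurableTypeR R * 'rV[R]_m) := (- p.1, p.2).
have consN : @rV_flip m \o @rV_cons R m = @rV_cons R m \o neg.
  apply/funext => -[x v] /=; apply/rowP => j; rewrite mxE.
  have [k ->|->] := fintype.unliftP ord0 j.
    by rewrite !rV_cons_lift.
  by rewrite !rV_cons_ord0.
have E : @rV_cons R m @^-1` (@rV_flip m @^-1` A) = neg @^-1` (@rV_cons R m @^-1` A).
  by rewrite -[LHS]comp_preimage -[RHS]comp_preimage consN.
transitivity ((lebesgue_measure \x lebesgue_rV R m)%E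
  (neg @^-1` (@rV_cons R m @^-1` A))).
  by rewrite -E.
rewrite H//.
by rewrite -[X in measurable X]setTI; exact: measurable_rV_cons.
Qed.

(** The section over each point of [B] is an interval of length [2 * r], whatever its centre. The
    twist in the group law turns translated boxes into such sheared strips. *)
Lemma product_skew_le m (B : set 'rV[R]_m) (c : 'rV[R]_m -> R) (r : R) :
  measurable B -> 0 <= r ->
  ((lebesgue_rV R m \x @lebesgue_measure R)
     [set p : 'rV[R]_m * measurableTypeR R | B p.1 /\ (`|c p.1 - p.2| <= r)%R] <=
   (2 * r)%:E * lebesgue_rV R m B)%E.
Proof.
move=> mB r0; rewrite /product_measure1 /=.
rewrite -integral_cst// [leRHS]integral_mkcond; apply: ge0_le_integralT => v //.
rewrite patchE; case: ifPn => [|] vB.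
  rewrite (_ : xsection _ _ = `[c v - r, c v + r]%classic).
    rewrite [leLHS]lebesgue_measure_cc; last by rewrite lerBlDr -addrA lerDl addr_ge0.
    by rewrite lee_fin; lra.
  apply/seteqP; split => s; rewrite /= /xsection/=.
    by rewrite inE/= => -[_]; rewrite ler_norml in_itv/=; lra.
  rewrite in_itv/= => H; rewrite inE/=; split; first by move: vB; rewrite inE.
  by rewrite ler_norml; lra.
rewrite (_ : xsection _ _ = set0) ?measure0//.
apply/seteqP; split => s //; rewrite /xsection/= inE/= => -[+ _].
by move/mem_set; rewrite (negbTE vB).
Qed.

End lebesgue_rV_lemmas.

(** * The function Omega *)

Section Cn_lemmas.
Context (R : realType) (n : nat).
Implicit Types z w : Cn R n.

Lemma normc_sqr (x : R[i]) : Normc.normc x ^+ 2 = complex.Re x ^+ 2 + complex.Im x ^+ 2.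
Proof. by case: x => a b /=; rewrite sqr_sqrtr// addr_ge0// sqr_ge0. Qed.

Lemma enorm_sqr z : enorm z ^+ 2 = \sum_i z ord0 i ^+ 2.
Proof.
rewrite sqr_sqrtr; last by apply: sumr_ge0 => j _; exact: sqr_ge0.
rewrite big_split_ord/= -big_split/=; apply: eq_bigr => j _.
by rewrite sqr_sqrtr ?addr_ge0 ?sqr_ge0.
Qed.

Lemma enorm_ge0 z : 0 <= enorm z.
Proof. exact: sqrtr_ge0. Qed.

Lemma enorm_coord z i : `|z ord0 i| <= enorm z.
Proof.
rewrite -(@ler_pXn2r _ 2)// ?nnegrE ?enorm_ge0//; last first.
rewrite enorm_sqr real_normK ?num_real// (bigD1 i)//= lerDl.
by apply: sumr_ge0 => j _; exact: sqr_ge0.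
Qed.

Lemma enorm_gt0 z : z != 0 -> 0 < enorm z.
Proof.
move=> z0; rewrite lt_neqAle enorm_ge0 andbT eq_sym; apply: contraNN z0 => /eqP E.
apply/eqP/rowP => i; rewrite mxE; apply/eqP; rewrite -normr_le0 -E.
exact: enorm_coord.
Qed.

Lemma enormN z : enorm (- z) = enorm z.
Proof.
apply/eqP; rewrite -(@eqrXn2 _ 2)// ?enorm_ge0// !enorm_sqr; apply/eqP.
by apply: eq_bigr => i _; rewrite mxE sqrrN.
Qed.

Lemma enormZ a z : enorm (a *: z) = `|a| * enorm z.
Proof.
apply/eqP; rewrite -(@eqrXn2 _ 2)// ?mulr_ge0 ?enorm_ge0//.
rewrite exprMn !enorm_sqr real_normK ?num_real// mulr_sumr; apply/eqP.
by apply: eq_bigr => i _; rewrite mxE exprMn.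
Qed.

Lemma Im_hdot z w : complex.Im (hdot z w) =
  \sum_j (z ord0 (rshift n j) * w ord0 (lshift n j) -
          z ord0 (lshift n j) * w ord0 (rshift n j)).
Proof.
rewrite /hdot raddf_sum; apply: eq_bigr => j _ /=.
by rewrite mulrN addrC.
Qed.

Lemma sum_le_enorm z w (f : 'I_n -> R) :
  (forall j, `|f j| <= (z ord0 (lshift n j) ^+ 2 + z ord0 (rshift n j) ^+ 2 +
     (w ord0 (lshift n j) ^+ 2 + w ord0 (rshift n j) ^+ 2)) / 2) ->
  `|\sum_j f j| <= (enorm z ^+ 2 + enorm w ^+ 2) / 2.
Proof.
move=> fb; apply: le_trans (ler_norm_sum _ _ _) _.
apply: le_trans (ler_sum _ (fun j _ => fb j)) _.
rewrite -mulr_suml !enorm_sqr !big_split_ord/= -!big_split/=.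
by [].
Qed.

(** An AM-GM substitute for Cauchy-Schwarz, in the squared form that suits the Koranyi norm. *)
Lemma Im_hdot_le z w :
  `|complex.Im (hdot z w)| <= (enorm z ^+ 2 + enorm w ^+ 2) / 2.
Proof.
rewrite Im_hdot; apply: sum_le_enorm => j.
set a := z _ (lshift _ _); set b := z _ _; set c := w _ (lshift _ _); set e := w _ _.
have := sqr_ge0 (b - c); have := sqr_ge0 (b + c).
have := sqr_ge0 (a - e); have := sqr_ge0 (a + e).
by rewrite ler_norml; nra.
Qed.

Lemma Im_hdotDr z w w' :
  complex.Im (hdot z (w + w')) = complex.Im (hdot z w) + complex.Im (hdot z w').
Proof. by rewrite !Im_hdot -big_split; apply: eq_bigr => j _; rewrite !mxE/=; ring. Qed.

Lemma Im_hdotDl z z' w :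
  complex.Im (hdot (z + z') w) = complex.Im (hdot z w) + complex.Im (hdot z' w).
Proof. by rewrite !Im_hdot -big_split; apply: eq_bigr => j _; rewrite !mxE/=; ring. Qed.

Lemma Im_hdotZr a z w : complex.Im (hdot z (a *: w)) = a * complex.Im (hdot z w).
Proof. by rewrite !Im_hdot mulr_sumr; apply: eq_bigr => j _; rewrite !mxE/=; ring. Qed.

Lemma Im_hdotZl a z w : complex.Im (hdot (a *: z) w) = a * complex.Im (hdot z w).
Proof. by rewrite !Im_hdot mulr_sumr; apply: eq_bigr => j _; rewrite !mxE/=; ring. Qed.

Lemma Im_hdotNr z w : complex.Im (hdot z (- w)) = - complex.Im (hdot z w).
Proof. by rewrite -scaleN1r Im_hdotZr mulN1r. Qed.

Lemma Im_hdotNl z w : complex.Im (hdot (- z) w) = - complex.Im (hdot z w).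
Proof. by rewrite -scaleN1r Im_hdotZl mulN1r. Qed.

Lemma Im_hdotC z w : complex.Im (hdot z w) = - complex.Im (hdot w z).
Proof. by rewrite !Im_hdot -sumrN; apply: eq_bigr => j _; ring. Qed.

Lemma Im_hdotxx z : complex.Im (hdot z z) = 0.
Proof. by rewrite Im_hdot big1// => j _; ring. Qed.

Lemma Im_hdot0r z : complex.Im (hdot z 0) = 0.
Proof. by rewrite -(scale0r z) Im_hdotZr mul0r. Qed.

Lemma enormD_sqr z w : 
  enorm (z + w) ^+ 2 <= 2 * enorm z ^+ 2 + 2 * enorm w ^+ 2.
Proof.
rewrite !enorm_sqr !mulr_sumr -big_split/=; apply: ler_sum => i _; rewrite mxE.
by have := sqr_ge0 (z ord0 i - w ord0 i); nra.
Qed.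

Lemma measurable_enorm_sqr : measurable_fun setT (fun z => enorm z ^+ 2).
Proof.
rewrite (_ : (fun z => _) = fun z => \sum_i z ord0 i ^+ 2); last first.
  by apply/funext => z; exact: enorm_sqr.
apply: measurable_sum => i; apply: measurable_funX; exact: measurable_rV_coord.
Qed.

End Cn_lemmas.

Section omega.
Context (R : realType) (n : nat).
Local Notation V := (Cn R n.+1).

(** A product of two real coordinates: it is odd under the reflection of the first one, and its sign
    can be controlled factor by factor. *)
Definition omega (z : V) : R[i] := (z ord0 ord0 * z ord0 (rshift n.+1 ord0))%:C.

Lemma hom0_omega z : hom0 omega z =
  (z ord0 ord0 * z ord0 (rshift n.+1 ord0) * (enorm z ^+ 2)^-1)%:C.
Proof. by rewrite /hom0 /omega !mxE; congr (_ %:C); rewrite expr2 invfM; ring. Qed.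

Lemma omega_smooth : smooth_on_sphere omega.
Proof.
have sm (f g : V -> R) : (forall z, f z = g z) -> rational_fun g ->
    smooth_on [set z | z != 0] f.
  by move=> /funext ->; exact: rational_smooth.
split; (apply: sm; first by move=> z; rewrite hom0_omega/=; reflexivity).
  apply: rational_mul.
    by apply: rational_mul; exact: rational_coord.
  apply: rational_inv => [|z z0]; last by rewrite expf_neq0// gt_eqF// enorm_gt0.
  rewrite (_ : (fun z => _) = fun z : V => \sum_i z ord0 i * z ord0 i).
    by apply: rational_sum => i; apply: rational_mul; exact: rational_coord.
  by apply/funext => z; rewrite enorm_sqr.
exact: rational_cst.
Qed.

Definition Cn_flip : V -> V := @rV_flip R (n + n.+1).

Lemma Cn_flip_preserving : measure_preserving (lebesgue_rV R (n.+1 + n.+1)) Cn_flip.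
Proof. exact: rV_flip_preserving. Qed.

Lemma enorm_flip (z : V) : enorm (Cn_flip z) = enorm z.
Proof.
apply/eqP; rewrite -(@eqrXn2 _ 2)// ?enorm_ge0// !enorm_sqr; apply/eqP.
by apply: eq_bigr => i _; rewrite mxE; case: ifP; rewrite ?sqrrN.
Qed.

(** The flip preserves the punctured ball and changes the sign of the real part; the imaginary part
    is zero. *)
Lemma omega_mean0 : sphere_integral omega = 0.
Proof.
rewrite /sphere_integral /cintegral.
set D := [set z | _].
have mD : measurable D.
  have := @measurable_enorm_sqr R n.+1 measurableT `]0, 1]%classic (measurable_itv _).
  rewrite setTI; congr measurable; rewrite predeqE => z /=.
  rewrite /D/= in_itv/= expr_le1 ?enorm_ge0// exprn_even_gt0//=.
  by rewrite [0 < enorm z]lt0r enorm_ge0 andbT.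
have -> : Rintegral (lebesgue_rV R (n.+1 + n.+1)) D
    (fun x => complex.Re (hom0 omega x)) = 0.
  rewrite Rintegral_mkcond; apply: Rintegral_odd Cn_flip_preserving _ _.
    apply/(measurable_restrictT _ mD); apply: measurable_funTS.
    (* The inverse is written as a power with exponent -1, since [powR] is known to be
       measurable. *)
    rewrite (_ : (fun z => _) = fun z : V => z ord0 ord0 *
       z ord0 (rshift n.+1 ord0) * powR (enorm z ^+ 2) (-1)).
      apply: measurable_funM.
        by apply: measurable_funM; exact: measurable_rV_coord.
      by apply: (measurableT_comp (measurable_powR (-1))); exact: measurable_enorm_sqr.
    by apply/funext => z; rewrite hom0_omega/= powR_inv1// sqr_ge0.
  move=> z; rewrite !patchE; have -> : (Cn_flip z \in D) = (z \in D).
    by apply/idP/idP; rewrite !inE /D/= enorm_flip.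
  case: ifP => _; last by rewrite oppr0.
  by rewrite !hom0_omega/= enorm_flip !mxE/=; ring.
have -> : Rintegral (lebesgue_rV R (n.+1 + n.+1)) D
    (fun x => complex.Im (hom0 omega x)) = 0.
  rewrite /Rintegral integral0_eq// => x _; by rewrite hom0_omega.
by rewrite mulr0.
Qed.

End omega.

(** * The Heisenberg group *)

Section heis_lemmas.
Context (R : realType) (n : nat).
Implicit Types x y z : heis R n.

Lemma hmulA x y z : hmul (hmul x y) z = hmul x (hmul y z).
Proof.
rewrite /hmul/= addrA Im_hdotDl Im_hdotDr; congr pair.
by ring.
Qed.

Lemma hmul0l x : hmul 0 x = x.
Proof.
case: x => v s; rewrite /hmul/= add0r Im_hdotC Im_hdot0r; congr pair.
by rewrite oppr0 mulr0 addr0 add0r.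
Qed.

Lemma hmulVK x y : hmul (hmul x (hinv y)) y = x.
Proof.
rewrite hmulA /hmul/= addNr addr0 Im_hdotNl Im_hdotxx Im_hdot0r; case: x => v s /=.
by congr pair; ring.
Qed.

Lemma hmulKV x y : hmul (hmul x y) (hinv y) = x.
Proof.
rewrite hmulA /hmul/= subrr addr0 Im_hdotNr Im_hdotxx Im_hdot0r; case: x => v s /=.
by congr pair; ring.
Qed.

Lemma hinvM x y : hinv (hmul x y) = hmul (hinv y) (hinv x).
Proof.
rewrite /hinv /hmul/= opprD [- x.1 + _]addrC.
rewrite Im_hdotNl Im_hdotNr [complex.Im (hdot y.1 _)]Im_hdotC.
by congr pair; ring.
Qed.

Lemma hinvK x : hinv (hinv x) = x.
Proof. by case: x => v s; rewrite /hinv/= !opprK. Qed.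

Lemma hdilM r x y : hdil r (hmul x y) = hmul (hdil r x) (hdil r y).
Proof.
rewrite /hdil /hmul/= scalerDr Im_hdotZl Im_hdotZr; congr pair; ring.
Qed.

Lemma hmulZZ (a b : R) x : hmul (a *: x) (b *: x) = (a + b) *: x.
Proof.
rewrite /hmul/= Im_hdotZl Im_hdotZr Im_hdotxx; case: x => v s /=.
rewrite scalerDl; congr pair.
by rewrite !mulr0 addr0 -scalerDl.
Qed.

Lemma hnorm_ge0 x : 0 <= hnorm x.
Proof. exact: sqrtr_ge0. Qed.

Lemma hnorm_pow4 x : hnorm x ^+ 4 = enorm x.1 ^+ 4 + x.2 ^+ 2.
Proof.
rewrite [LHS](exprM _ 2 2) sqr_sqrtr ?sqrtr_ge0// sqr_sqrtr//.
apply: addr_ge0; last exact: sqr_ge0.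
exact: (exprn_ge0 4 (enorm_ge0 x.1)).
Qed.

Lemma le_hnorm x (r : R) : 0 <= r ->
  enorm x.1 ^+ 4 + x.2 ^+ 2 <= r ^+ 4 -> hnorm x <= r.
Proof.
by move=> r0; rewrite -hnorm_pow4 ler_pXn2r// nnegrE hnorm_ge0.
Qed.

Lemma hnorm_eq x y : enorm x.1 = enorm y.1 -> `|x.2| = `|y.2| -> hnorm x = hnorm y.
Proof.
by rewrite /hnorm => -> E; rewrite -(real_normK (num_real x.2)) E real_normK ?num_real.
Qed.

Lemma hnormV x : hnorm (hinv x) = hnorm x.
Proof. by apply: hnorm_eq; rewrite /= ?enormN ?normrN. Qed.

Lemma hnorm_dil r x : 0 <= r -> hnorm (hdil r x) = r * hnorm x.
Proof.
move=> r0; apply/eqP; rewrite -(@eqrXn2 _ 4)// ?mulr_ge0 ?hnorm_ge0//.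
rewrite exprMn !hnorm_pow4/= enormZ ger0_norm// !exprMn; apply/eqP; ring.
Qed.

Lemma enorm_le_hnorm x : enorm x.1 <= hnorm x.
Proof.
by rewrite -(@ler_pXn2r _ 4)// ?nnegrE ?enorm_ge0 ?hnorm_ge0// hnorm_pow4 lerDl sqr_ge0.
Qed.

Lemma norm_snd_le_hnorm x : `|x.2| <= hnorm x ^+ 2.
Proof.
rewrite -(@ler_pXn2r _ 2)// ?nnegrE ?sqr_ge0// -exprM hnorm_pow4.
by rewrite real_normK ?num_real// lerDr exprn_ge0// enorm_ge0.
Qed.

(* The sharp constant is 1; the constant 2 needs AM-GM only. *)
Lemma hnormM x y : hnorm (hmul x y) <= 2 * (hnorm x + hnorm y).
Proof.
apply: le_hnorm => /=; first by rewrite mulr_ge0// addr_ge0 ?hnorm_ge0.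
have x0 := hnorm_ge0 x; have y0 := hnorm_ge0 y.
have hx : enorm x.1 ^+ 2 <= hnorm x ^+ 2.
  by rewrite ler_pXn2r ?nnegrE ?enorm_ge0// enorm_le_hnorm.
have hy : enorm y.1 ^+ 2 <= hnorm y ^+ 2.
  by rewrite ler_pXn2r ?nnegrE ?enorm_ge0// enorm_le_hnorm.
have sx := norm_snd_le_hnorm x; have sy := norm_snd_le_hnorm y.
have I := Im_hdot_le x.1 y.1; have D := enormD_sqr x.1 y.1.
have sq2 (a b : R) : 0 <= a -> a <= b -> a ^+ 2 <= b ^+ 2 by nra.
set p := hnorm x ^+ 2 + hnorm y ^+ 2.
have p0 : 0 <= p by rewrite addr_ge0 ?sqr_ge0.
have pxy : p <= (hnorm x + hnorm y) ^+ 2 by rewrite /p; nra.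
have d2 : enorm (x.1 + y.1) ^+ 2 <= 2 * p by apply: le_trans D _; rewrite /p; lra.
have s2 : `|x.2 + y.2 + 2 * complex.Im (hdot x.1 y.1)| <= 2 * p.
  move: sx sy I; rewrite !ler_norml /p => sx sy I; apply/andP; split; lra.
have -> : (2 * (hnorm x + hnorm y)) ^+ 4 = (4 * (hnorm x + hnorm y) ^+ 2) ^+ 2 by ring.
apply: (@le_trans _ _ ((4 * p) ^+ 2)); last first.
  by apply: sq2; lra.
have d4 : enorm (x.1 + y.1) ^+ 4 <= (2 * p) ^+ 2.
  by rewrite [leLHS](exprM _ 2 2); apply: sq2; rewrite ?sqr_ge0.
have s4 : (x.2 + y.2 + 2 * complex.Im (hdot x.1 y.1)) ^+ 2 <= (2 * p) ^+ 2.
  by rewrite -(@real_normK _ (_ + _)) ?num_real//; apply: sq2.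
by have := lerD d4 s4; nra.
Qed.

Lemma measurable_heis d (T : measurableType d) (f : T -> heis R n) :
  (forall i, measurable_fun setT (fun t => (f t).1 ord0 i)) ->
  measurable_fun setT (fun t => (f t).2 : measurableTypeR R) ->
  measurable_fun setT f.
Proof.
by move=> m1 m2; apply/measurable_fun_pairP; split => //; exact: measurable_fun_rV.
Qed.

Lemma measurable_heis_coord i : measurable_fun setT (fun x => x.1 ord0 i).
Proof. exact: (measurableT_comp (measurable_rV_coord i) measurable_fst). Qed.

Lemma measurable_heis_snd : measurable_fun setT (fun x => x.2 : R).
Proof. exact: measurable_snd. Qed.

Lemma measurable_hmulV y : measurable_fun setT (fun x => hmul y (hinv x)).
Proof.
apply: measurable_heis => [i|] /=.
  rewrite (_ : (fun x => _) = fun x => y.1 ord0 i - x.1 ord0 i).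
    by apply: measurable_funB => //; exact: measurable_heis_coord.
  by apply/funext => x /=; rewrite !mxE.
rewrite (_ : (fun x => _) = fun x => y.2 - x.2 + 2 *
  \sum_(j < n) ((- y.1 ord0 (rshift n j)) * x.1 ord0 (lshift n j) + 
          y.1 ord0 (lshift n j) * x.1 ord0 (rshift n j))).
  apply: measurable_funD.
    by apply: measurable_funB => //; exact: measurable_heis_snd.
  apply: measurable_funM => //; apply: measurable_sum => j.
  by apply: measurable_funD; apply: measurable_funM => //; exact: measurable_heis_coord.
apply/funext => x /=; rewrite Im_hdot; congr (_ + 2 * _).
by apply: eq_bigr => j _; rewrite !mxE; ring.
Qed.

Lemma measurable_hdil r : measurable_fun setT (@hdil R n r).
Proof.
apply: measurable_heis => [i|] /=.
  rewrite (_ : (fun x => _) = fun x => r * x.1 ord0 i).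
    by apply: measurable_funM => //; exact: measurable_heis_coord.
  by apply/funext => x /=; rewrite !mxE.
by apply: measurable_funM => //; exact: measurable_heis_snd.
Qed.

End heis_lemmas.

(** * Measurability of continuous functions on the group *)

Section continuous_measurable.
Context (R : realType) (n : nat).
Local Notation V := (heis R n).

(** Preimages are countable unions of level sets of [q]. *)
Lemma measurable_countable_comp d (T : measurableType d) (I : countType)
    (q : T -> I) (g : I -> R) :
  (forall i, measurable [set x | q x = i]) -> measurable_fun setT (g \o q).
Proof.
move=> mq _ Y mY; rewrite setTI.
rewrite (_ : _ @^-1` _ = \bigcup_i [set x | q x = i /\ Y (g i)]).
  apply: countable_bigcupT_measurable => [|i]; first exact: countableP.
  have [Yi|nYi] := pselect (Y (g i)).
    rewrite (_ : mkset _ = [set x | q x = i]); first exact: mq.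
    by apply/seteqP; split => x /= => [[]|].
  rewrite (_ : mkset _ = set0); first exact: measurable0.
  by apply/seteqP; split => x /= => [[]|].
apply/seteqP; split => x /=; first by exists (q x).
by move=> [i _ [<-]].
Qed.

Let fl (k : nat) (a : R) : int := Num.floor (k.+1%:R * a).

Let measurable_fl k (z : int) : measurable [set a : R | fl k a = z].
Proof.
have k0 : (0 : R) < k.+1%:R by rewrite ltr0n.
rewrite (_ : mkset _ = `[z%:~R / k.+1%:R, (z + 1)%:~R / k.+1%:R[%classic).
  exact: measurable_itv.
apply/seteqP; split => a /=; rewrite in_itv/= ler_pdivrMr// ltr_pdivlMr// mulrC.
  by move=> <-; exact: floor_itv.
by move=> H; exact: floor_def.
Qed.

Let fl_near k a : `|a - (fl k a)%:~R / k.+1%:R| <= k.+1%:R^-1.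
Proof.
have k0 : (0 : R) < k.+1%:R by rewrite ltr0n.
have /andP[+ +] := floor_itv (k.+1%:R * a).
rewrite -/(fl k a) mulrC -ler_pdivrMr// intrD mulrC => h1 h2.
rewrite ger0_norm ?subr_ge0// lerBlDr -[X in _ <= X + _]mul1r -mulrDl.
by rewrite ler_pdivlMr// [leRHS]addrC mulrC; exact: ltW.
Qed.

(* The sigma-algebra of 'rV is generated by the coordinates, not defined as the
   Borel one; f is the limit of its compositions with the roundings of the
   coordinates to multiples of 1 / (k + 1). *)
Lemma continuous_heis_measurable (f : V -> R) :
  (forall x, {for x, continuous f}) -> measurable_fun setT f.
Proof.
move=> cf.
pose q k (x : V) : 'rV[int]_(n + n) * int := (\row_i fl k (x.1 ord0 i), fl k x.2).
pose g k (p : 'rV[int]_(n + n) * int) : V :=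
  (\row_i ((p.1 ord0 i)%:~R / k.+1%:R), p.2%:~R / k.+1%:R).
apply: (@measurable_fun_cvg _ _ _ _ (fun k => (f \o g k) \o q k)) => [k|x _].
  apply: measurable_countable_comp => -[z s].
  pose F i := [set a | fl k a = z ord0 i].
  rewrite (_ : mkset _ = [set v : 'rV[R]_(n + n) | forall i, F i (v ord0 i)] `*`
      [set a : measurableTypeR R | fl k a = s]).
    apply: measurableX; last exact: measurable_fl.
    by apply: measurable_rV_forall => i; exact: measurable_fl.
  apply/seteqP; split => -[v a] /=.
    by move=> [/rowP vz <-]; split => // i; rewrite /F/= -vz mxE.
  by move=> [vz <-]; rewrite /q/=; congr pair; apply/rowP => i; rewrite mxE; exact: vz.
have gx : (fun k => g k (q k x)) @ \oo --> x.
  apply/cvg_ballP => e e0; near=> k.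
  have ke : k.+1%:R^-1 < e.
    near: k; exact: (near_infty_natSinv_lt (PosNum e0)).
  split; last exact: le_lt_trans (fl_near _ _) ke.
  split=> // i j.
  by rewrite /ball/= !mxE (ord1 i); apply: le_lt_trans (fl_near _ _) ke.
exact: (cvg_comp _ _ gx (cf x)).
Unshelve. all: by end_near.
Qed.

End continuous_measurable.

(** * Integrability of the decay of order Q + 1 *)

Section decay_integral.
Context (R : realType) (n : nat).
Local Notation V := (heis R n).
Local Notation mu := (@hmeasure R n).
Local Notation Q := (hdim n).

(** A box that contains the Koranyi ball of radius [r] and whose explicit volume is still a multiple
    of r^Q. *)
Definition hbox (r : R) : set V :=
  [set p : V | (forall i, `|p.1 ord0 i| <= r) /\ `|p.2| <= r ^+ 2].

Lemma measurable_hbox r : measurable (hbox r).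
Proof.
rewrite (_ : hbox r = [set v : 'rV[R]_(n + n) | forall i, - r <= v ord0 i <= r] `*`
    (`[- r ^+ 2, r ^+ 2]%classic : set (measurableTypeR R))).
  by apply: measurableX; [exact: measurable_rV_box|exact: measurable_itv].
apply/seteqP; split => -[v s] [/= vr sr]; split.
- by move=> i /=; rewrite -ler_norml.
- by rewrite /= in_itv/= -ler_norml.
- by move=> i /=; rewrite ler_norml.
- by move: sr => /=; rewrite in_itv/= ler_norml.
Qed.

Lemma hbox_hnorm (r : R) x : hnorm x <= r -> hbox r x.
Proof.
move=> xr; have r0 := le_trans (hnorm_ge0 x) xr; split => [i|].
  exact: le_trans (enorm_coord _ _) (le_trans (enorm_le_hnorm _) xr).
apply: le_trans (norm_snd_le_hnorm x) _.
by rewrite ler_pXn2r// nnegrE hnorm_ge0.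
Qed.

(** The preimage is a sheared strip of height 2 r^2 over the cube of side 2 r centred at [y.1]; the
    exponents 2n and 2 add up to Q. *)
Lemma hmeasure_hbox_le y (r : R) : 0 <= r ->
  (mu ((fun w => hmul y (hinv w)) @^-1` hbox r) <= (2 ^+ (n + n).+1 * r ^+ Q)%:E)%E.
Proof.
move=> r0.
pose B := [set v : 'rV[R]_(n + n) | forall i,
  y.1 ord0 i - r <= v ord0 i <= y.1 ord0 i + r].
pose c (v : 'rV[R]_(n + n)) := y.2 + 2 * complex.Im (hdot y.1 (- v)).
have mB : measurable B by exact: measurable_rV_box.
have := @product_skew_le R _ B c (r ^+ 2) mB (sqr_ge0 _).
rewrite lebesgue_rV_box; last by move=> i /=; lra.
rewrite (eq_bigr (fun=> 2 * r)); last by move=> i _ /=; ring.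
rewrite prodr_const card_ord -EFinM.
have -> : 2 * r ^+ 2 * (2 * r) ^+ (n + n) = 2 ^+ (n + n).+1 * r ^+ Q.
  rewrite /hdim exprMn [2 ^+ _.+1]exprS [r ^+ (_ + 2)]exprD.
  move: (2 ^+ (n + n)) (r ^+ (n + n)) => u v. ring.
apply: le_trans; rewrite le_eqVlt; apply/orP; left; apply/eqP.
congr (product_measure1 _ _ _); apply/seteqP; split => -[v s] [/= H1 H2]; split.
- by move=> i; have := H1 i; rewrite !mxE ler_norml; lra.
- by move: H2; rewrite /c/= addrAC.
- by move=> i; have := H1 i; rewrite !mxE ler_norml; lra.
- by move: H2; rewrite /c/= addrAC.
Qed.

Lemma exists_pow2 (a : R) : 1 <= a -> exists k, 2 ^+ k <= a < 2 ^+ k.+1.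
Proof.
move=> a1; have ex : exists k, a < 2 ^+ k.
  exists (Num.bound a); apply: lt_trans (archi_boundP _) _; first lra.
  by rewrite -natrX ltr_nat ltn_expl.
case: (ex_minnP ex) => -[|k] ak kmin; first by move: ak; rewrite expr0; lra.
exists k; rewrite ak andbT leNgt; apply/negP => /kmin.
by rewrite ltnn.
Qed.

(** The factor 2 is the sum of the series of 2^(-k), the middle factor comes from the volume of a
    box, and 2^Q from using the outer radius 2^(k+1) t of each shell. *)
Definition decay_const : R := 2 * (2 ^+ (n + n).+1 * 2 ^+ Q).

Lemma decay_const_ge0 : 0 <= decay_const.
Proof. by rewrite !mulr_ge0// exprn_ge0. Qed.

(* Split according to the k with 2^k <= 1 + |y w^-1| / t < 2^(k+1). *)
Lemma decay_integral_le y (c t : R) : 0 <= c -> 0 < t ->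
  (\int[mu]_w (c * ((1 + hnorm (hmul y (hinv w)) / t) ^+ Q.+1)^-1)%:E <=
   (decay_const * (c * t ^+ Q))%:E)%E.
Proof.
move=> c0 t0.
pose S k := (fun w => hmul y (hinv w)) @^-1` hbox (2 ^+ k.+1 * t).
have mS k : measurable (S k).
  by rewrite -[X in measurable X]setTI; exact: measurable_hmulV (measurable_hbox _).
pose a k : R := c * ((2 ^+ k) ^+ Q.+1)^-1.
have a0 k : 0 <= a k by rewrite mulr_ge0// invr_ge0 !exprn_ge0.
pose g k w := ((a k)%:E * (\1_(S k) w)%:E)%E.
have g0 k w : (0 <= g k w)%E by rewrite mule_ge0// lee_fin.
apply: (@le_trans _ _ (\int[mu]_w (\sum_(0 <= k <oo) g k w))%E).
  apply: ge0_le_integralT => w; have N0 := hnorm_ge0 (hmul y (hinv w)).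
    by rewrite lee_fin mulr_ge0// invr_ge0 exprn_ge0// addr_ge0// divr_ge0// ltW.
  have a1 : 1 <= 1 + hnorm (hmul y (hinv w)) / t by rewrite lerDl divr_ge0// ltW.
  have [k /andP[ka ak]] := exists_pow2 a1.
  apply: le_trans (nneseries_lim_ge k.+1 (fun i _ _ => g0 i w)).
  rewrite big_nat_recr//=.
  apply: (@le_trans _ _ (g k w)); last by rewrite leeDr// sume_ge0.
  rewrite /g indicE mem_set ?mule1 ?lee_fin.
    apply: ler_wpM2l => //.
    rewrite lef_pV2 ?posrE ?exprn_gt0//; last by apply: lt_le_trans a1.
    by rewrite ler_pXn2r// nnegrE ?exprn_ge0// addr_ge0// divr_ge0// ltW.
  apply: hbox_hnorm; rewrite -ler_pdivrMr//; lra.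
have mg k : measurable_fun setT (g k).
  by apply/measurable_EFinP; apply: measurable_funM => //; exact: measurable_indic.
rewrite (integral_nneseries mu measurableT mg); last by move=> k w _; exact: g0.
(* The k-th term is at most the total bound divided by 2^(k+1): volumes grow like 2^(kQ), while the
   integrand decays like 2^(-k(Q+1)). *)
apply: le_trans (epsilon_trick0 xpredT _); last first.
  by rewrite !mulr_ge0 ?decay_const_ge0// exprn_ge0// ltW.
apply: lee_nneseries => [k _ _|k _]; first exact: integral_ge0.
rewrite /g ge0_integralZl_EFin//; last first.
  by apply/measurable_EFinP; exact: (measurable_indic (mS k)).
rewrite integral_indic// setIT.
apply: (@le_trans _ _ ((a k)%:E * (2 ^+ (n + n).+1 * (2 ^+ k.+1 * t) ^+ Q)%:E)%E).
  apply: lee_wpmul2l; first by rewrite lee_fin.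
  by apply: hmeasure_hbox_le; rewrite mulr_ge0 ?exprn_ge0// ltW.
rewrite -EFinM lee_fin le_eqVlt; apply/orP; left; apply/eqP.
rewrite /a /decay_const natrX !exprMn -!exprM.
have -> : (2 : R) ^+ (k * Q.+1) = 2 ^+ (k * Q) * 2 ^+ k by rewrite mulnS addnC exprD.
rewrite mulSn !exprD (exprS _ k) .
have : (2 : R) ^+ k != 0 by rewrite expf_neq0.
have : (2 : R) ^+ (k * Q) != 0 by rewrite expf_neq0.
move: (2 ^+ (k * Q)) (2 ^+ k) => u v u0 v0.
by field; rewrite u0 v0.
Qed.

End decay_integral.

(** * Test functions *)

Section test_functions.
Context (R : realType) (n : nat).
Local Notation V := (heis R n).
Local Notation Q := (hdim n).

Lemma hmul_line (u v : V) (s : R) :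
  hmul u (s *: v) = s *: ((v.1, v.2 + 2 * complex.Im (hdot u.1 v.1)) : V) + u.
Proof.
case: u v => [u1 u2] [v1 v2]; rewrite /hmul/= Im_hdotZr; congr pair.
  by rewrite addrC.
change (u2 + s * v2 + 2 * (s * complex.Im (hdot u1 v1)) =
  s * (v2 + 2 * complex.Im (hdot u1 v1)) + u2 :> R).
ring.
Qed.

(* The curve s |-> u (s v) is an affine line, so no chain rule is needed. *)
Lemma left_inv_is_derive (phi : V -> R) (u v : V) (s : R) : smooth_on setT phi ->
  is_derive s 1 (fun s : R => phi (hmul u (s *: v)))
    (left_inv_derive v phi (hmul u (s *: v))).
Proof.
move=> sphi; set p := hmul u (s *: v).
pose F (a : R) := phi (hmul u (a *: v)); pose G (a : R) := phi (hmul p (a *: v)).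
(* A shift of the parameter by [s] moves the base point to [p], so the derivative at [s] becomes one
   at 0. *)
have FG h : F (h + s) = G h by rewrite /F /G /p hmulA hmulZZ addrC.
pose w : V := (v.1, v.2 + 2 * complex.Im (hdot p.1 v.1)).
have GE : G = fun h => phi (h *: w + p) by apply/funext => h; rewrite /G hmul_line.
have dG : derivable G 0 1.
  rewrite GE; have [_ /(_ w) dphi] := sphi [::] p I.
  have [H _] := derivable1P phi p w.
  exact: (H dphi).
have E : (fun h : R => h^-1 *: ((F \o shift s) (h *: (1 : R)) - F s)) =
         (fun h : R => h^-1 *: ((G \o shift 0) (h *: (1 : R)) - G 0)).
  by apply/funext => h /=; rewrite addr0 FG -(FG 0) add0r.
apply: DeriveDef; first by rewrite /derivable E.
by rewrite /left_inv_derive derive1E /derive E.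
Qed.

(** The mean value theorem along the curve s |-> u (s v). *)
Lemma hmul_step_le (phi : V -> R) (u v : V) (a B : R) : smooth_on setT phi ->
  (forall s : R, `|s| <= `|a| -> `|left_inv_derive v phi (hmul u (s *: v))| <= B) ->
  `|phi (hmul u (a *: v)) - phi u| <= `|a| * B.
Proof.
move=> sphi dB; pose F (s : R) := phi (hmul u (s *: v)).
pose dF (s : R) := left_inv_derive v phi (hmul u (s *: v)).
have dFP (s : R) : is_derive s (1 : R) F (dF s) by exact: left_inv_is_derive.
have cF b c : {within `[b, c], continuous F}.
  by apply: derivable_within_continuous => s _; have [] := dFP s.
have F0 : F 0 = phi u.
  rewrite /F hmul_line scale0r add0r.
  by [].
rewrite -F0 -/(F a).
have [a0|a0] := leP 0 a.
  have [s] := MVT_segment a0 (fun s _ => dFP s) (cF 0 a).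
  rewrite in_itv/= => /andP[s0 sa] ->; rewrite subr0 normrM mulrC.
  by apply: ler_wpM2l => //; apply: dB; rewrite !ger0_norm.
have [s] := MVT_segment (ltW a0) (fun s _ => dFP s) (cF a 0).
rewrite in_itv/= => /andP[sa s0]; rewrite distrC => ->; rewrite sub0r normrM normrN mulrC.
by apply: ler_wpM2l => //; apply: dB; rewrite !ler0_norm ?lerN2// ltW.
Qed.

Definition hweight (x : V) : R := (1 + hnorm x) ^+ (2 * Q.+1).

(** The properties of the real and imaginary parts of a normalized test function that enter the
    estimates; [hweight] has the exponent (N + 1)(Q + 1) with N = 1. *)
Definition test_component (psi : V -> R) : Prop :=
  [/\ smooth_on setT psi, forall x, `|psi x| <= (hweight x)^-1 &
      forall j x, `|left_inv_derive (hbasis R j) psi x| <= (hweight x)^-1].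

Lemma hweight_gt0 x : 0 < hweight x.
Proof. by rewrite exprn_gt0// ltr_pwDl// hnorm_ge0. Qed.

Lemma normr_Re_le (z : R[i]) : `|complex.Re z| <= Normc.normc z.
Proof.
case: z => a b /=; rewrite -(sqrtr_sqr a) ler_sqrt ?lerDl ?sqr_ge0//.
by rewrite addr_ge0// sqr_ge0.
Qed.

Lemma normr_Im_le (z : R[i]) : `|complex.Im z| <= Normc.normc z.
Proof.
case: z => a b /=; rewrite -(sqrtr_sqr b) ler_sqrt ?lerDr ?sqr_ge0//.
by rewrite addr_ge0// sqr_ge0.
Qed.

Lemma normc_le (z : R[i]) : Normc.normc z <= `|complex.Re z| + `|complex.Im z|.
Proof.
rewrite -(@ler_pXn2r _ 2)// ?nnegrE ?addr_ge0//; last by case: z => a b; exact: sqrtr_ge0.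
rewrite normc_sqr -(real_normK (num_real (complex.Re z))).
rewrite -(real_normK (num_real (complex.Im z))).
have := normr_ge0 (complex.Re z); have := normr_ge0 (complex.Im z); nra.
Qed.

Lemma FS_normalized_components phi : FS_normalized phi ->
  test_component (fun x => complex.Re (phi x)) /\
  test_component (fun x => complex.Im (phi x)).
Proof.
move=> [[[sRe _] [sIm _]] size deriv].
have ww x : (1 + hnorm x) ^+ (2 * (hdim n + 1)) = hweight x by rewrite addn1.
have le x (z : R[i]) (b : R) : `|b| <= Normc.normc z -> 
    (1 + hnorm x) ^+ (2 * (hdim n + 1)) * Normc.normc z <= 1 -> `|b| <= (hweight x)^-1.
  move=> bz; rewrite ww -ler_pdivlMl ?hweight_gt0// mulr1; exact: le_trans.
split; split => // [x|j x].
- exact: le (normr_Re_le _) (size x).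
- exact: le (normr_Re_le _) (deriv j x).
- exact: le (normr_Im_le _) (size x).
- exact: le (normr_Im_le _) (deriv j x).
Qed.

Definition hscale (t : R) (psi : V -> R) (x : V) : R :=
  (t ^+ Q)^-1 * psi (hdil t^-1 x).

(* The homogeneous degree of the basis vectors under the dilations. *)
Definition hdegree (j : option 'I_(n + n)) : nat := if j is Some _ then 1 else 2.

Lemma hdil_hbasis (r s : R) j :
  hdil r (s *: hbasis R j) = (r ^+ hdegree j * s) *: hbasis R j :> V.
Proof.
case: j => [k|]; rewrite /hdil/=; congr pair; rewrite ?scalerA ?scaler0 ?expr1//.
- by rewrite /GRing.scale/= !mulr0.
- by rewrite /GRing.scale/= mulrA.
Qed.

(** A derivative of homogeneous degree d costs t^(-Q-d). The weight makes up for small [t]: t max(1,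
    X / t) is at least [X], and Q + d is at most 2 (Q + 1). The bound is therefore uniform in
    [t]. *)
Lemma hscale_step_le (psi : V -> R) j (u : V) (a t X : R) :
  test_component psi -> 0 < t -> 0 < X ->
  (forall s : R, `|s| <= `|a| -> X <= t + hnorm (hmul u (s *: hbasis R j))) ->
  `|hscale t psi (hmul u (a *: hbasis R j)) - hscale t psi u| <=
  `|a| / X ^+ (Q + hdegree j).
Proof.
move=> [spsi _ dpsi] t0 X0 uX.
rewrite /hscale -mulrBr hdilM hdil_hbasis normrM.
rewrite (ger0_norm (x := _^-1)) ?invr_ge0 ?exprn_ge0 ?(ltW t0)//.
(* [M] bounds the base of the weight from below along the whole step; being at least 1, it allows
   the exponent to be lowered. *)
pose M := Num.max 1 (X / t).
have M1 : 1 <= M by rewrite le_max lexx.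
have M0 : 0 < M by exact: lt_le_trans M1.
have Mt : X / t <= M by rewrite le_max lexx orbT.
have td : 0 < t ^+ hdegree j by rewrite exprn_gt0.
have step : `|psi (hmul (hdil t^-1 u) ((t^-1 ^+ hdegree j * a) *: hbasis R j)) -
     psi (hdil t^-1 u)| <= `|t^-1 ^+ hdegree j * a| * (M ^+ (2 * Q.+1))^-1.
  apply: hmul_step_le => // s sa; apply: le_trans (dpsi _ _) _.
  rewrite /hweight lef_pV2 ?posrE ?exprn_gt0//; last by rewrite ltr_pwDl// hnorm_ge0.
  apply: lerXn2r; rewrite ?nnegrE ?(ltW M0)//; first by rewrite addr_ge0// hnorm_ge0.
  rewrite ge_max lerDl hnorm_ge0/= ler_pdivrMr//.
  have -> : s = t^-1 ^+ hdegree j * (t ^+ hdegree j * s).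
    by rewrite mulrA -exprMn mulVf ?gt_eqF// expr1n mul1r.
  rewrite -hdil_hbasis -hdilM hnorm_dil ?invr_ge0 ?(ltW t0)//.
  rewrite mulrDl mul1r mulrC mulrA divff ?gt_eqF// mul1r; apply: uX.
  move: sa; rewrite !normrM exprVn normfV (gtr0_norm td) => sa.
  by rewrite mulrC -ler_pdivlMr// mulrC.
apply: le_trans (ler_wpM2l _ step) _; first by rewrite invr_ge0 exprn_ge0// ltW.
rewrite normrM exprVn normfV (gtr0_norm td).
have XM : X ^+ (Q + hdegree j) <= t ^+ (Q + hdegree j) * M ^+ (2 * Q.+1).
  apply: (@le_trans _ _ (t ^+ (Q + hdegree j) * M ^+ (Q + hdegree j))).
    rewrite -exprMn; apply: lerXn2r;
      rewrite ?nnegrE ?mulr_ge0 ?(ltW t0) ?(ltW X0) ?(ltW M0)//.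
    by rewrite mulrC -ler_pdivrMr.
  rewrite ler_pM2l ?exprn_gt0//; apply: ler_weXn2l => //.
  apply: (@leq_trans (Q + 2)); first by rewrite leq_add2l; case: (j).
  by rewrite addn2 mul2n -addnn addSn addnS !ltnS leq_addr.
have -> : (t ^+ Q)^-1 * ((t ^+ hdegree j)^-1 * `|a| / M ^+ (2 * Q.+1)) =
   `|a| / (t ^+ (Q + hdegree j) * M ^+ (2 * Q.+1)).
  by rewrite exprD !invfM; ring.
apply: ler_wpM2l => //.
by rewrite lef_pV2 ?posrE ?mulr_gt0 ?exprn_gt0.
Qed.

(** Half of the weight is given up: the exponent Q + 1 already yields an L^1 bound independent of
    [t]. *)
Lemma hscale_size_le (psi : V -> R) (x : V) (t : R) : test_component psi -> 0 < t ->
  `|hscale t psi x| <= (t ^+ Q)^-1 * ((1 + hnorm x / t) ^+ Q.+1)^-1.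
Proof.
move=> [_ size _] t0; rewrite /hscale normrM ger0_norm ?invr_ge0 ?exprn_ge0 ?(ltW t0)//.
apply: ler_wpM2l; first by rewrite invr_ge0 exprn_ge0// ltW.
apply: le_trans (size _) _; rewrite /hweight hnorm_dil ?invr_ge0 ?(ltW t0)// [t^-1 * _]mulrC.
have h1 : 1 <= 1 + hnorm x / t by rewrite lerDl divr_ge0 ?hnorm_ge0// ltW.
have h0 := lt_le_trans ltr01 h1.
rewrite lef_pV2 ?posrE ?exprn_gt0//; apply: ler_weXn2l => //.
by rewrite leq_pmull.
Qed.

End test_functions.

(** * The atom *)

Section atom.
Context (R : realType) (n : nat).
Local Notation V := (heis R n.+1).
Local Notation mu := (@hmeasure R n.+1).
Local Notation Q := (hdim n.+1).

Definition heis_flip (w : V) : V := (@Cn_flip R n w.1, w.2).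

Lemma heis_flipK : involutive heis_flip.
Proof. by case=> v s; rewrite /heis_flip/=; congr pair; exact: rV_flipK. Qed.

Lemma heis_flip_preserving : measure_preserving mu heis_flip.
Proof.
exact: (@measure_preserving_fst _ _ _ _ _ _ (@lebesgue_measure R) _
  (@Cn_flip_preserving R n)).
Qed.

(** The first coordinate runs over [1, 2], away from the mirror, so that the two boxes are separated
    by a gap of width 2. *)
Definition atom_lo (i : 'I_(n.+1 + n.+1)) : R := if i == ord0 then 1 else -1.
Definition atom_hi (i : 'I_(n.+1 + n.+1)) : R := if i == ord0 then 2 else 1.

Definition atom_base : set 'rV[R]_(n.+1 + n.+1) :=
  [set v | forall i, atom_lo i <= v ord0 i <= atom_hi i].

Definition atom_box : set V := atom_base `*` `[-1, 1]%classic.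

Definition atom (w : V) : R := \1_atom_box w - \1_atom_box (heis_flip w).

Lemma measurable_atom_base : measurable atom_base.
Proof. exact: measurable_rV_box. Qed.

Lemma measurable_atom_box : measurable atom_box.
Proof. by apply: measurableX; [exact: measurable_atom_base|exact: measurable_itv]. Qed.

Lemma hmeasure_atom_box : exists2 m : R, 0 < m & mu atom_box = m%:E.
Proof.
exists ((\prod_i (atom_hi i - atom_lo i)) * (1 - -1)).
  apply: mulr_gt0; last lra.
  by apply: prodr_gt0 => i _; rewrite /atom_hi /atom_lo; case: ifP => _; lra.
transitivity (lebesgue_rV R (n.+1 + n.+1) atom_base *
    lebesgue_measure (`[(-1)%R, 1%R]%classic : set R))%E.
  by apply: product_measure1E; [exact: measurable_atom_base|exact: measurable_itv].
rewrite lebesgue_rV_box; last by move=> i; rewrite /atom_hi /atom_lo; case: ifP => _; lra.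
by rewrite lebesgue_measure_cc ?EFinM//; lra.
Qed.

Lemma atom_flip w : atom (heis_flip w) = - atom w.
Proof. by rewrite /atom heis_flipK opprB. Qed.

Lemma atom_box_flip w : atom_box w -> ~ atom_box (heis_flip w).
Proof.
move=> [/= /(_ ord0) + _] [/= /(_ ord0) + _].
by rewrite /atom_lo /atom_hi !mxE !eqxx/=; lra.
Qed.

Lemma measurable_atom : measurable_fun setT atom.
Proof.
apply: measurable_funB; first exact: (measurable_indic measurable_atom_box).
apply: (@measurableT_comp _ _ _ _ _ _ (\1_atom_box : V -> R)).
  exact: (measurable_indic measurable_atom_box).
by have [] := heis_flip_preserving.
Qed.

Lemma normr_atom_le w : `|atom w| <= \1_atom_box w + \1_atom_box (heis_flip w).
Proof.
apply: le_trans (ler_normB _ _) _.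
by rewrite !ger0_norm// indicE; case: (_ \in _).
Qed.

Lemma normr_atom_le1 w : `|atom w| <= 1.
Proof.
rewrite /atom !indicE.
case: (boolP (w \in _)) => wB; case: (boolP (heis_flip w \in _)) => wB' /=.
- by rewrite subrr normr0.
- by rewrite subr0 normr1.
- by rewrite sub0r normrN normr1.
- by rewrite subrr normr0.
Qed.

Lemma atom_neq0 w : atom w != 0 -> atom_box w \/ atom_box (heis_flip w).
Proof.
rewrite /atom !indicE; case: (boolP (w \in _)) => [/set_mem|_]; first by left.
case: (boolP (heis_flip w \in _)) => [/set_mem|_]; first by right.
by rewrite subrr eqxx.
Qed.

Lemma atom_box_bounded w : atom_box w -> (forall i, `|w.1 ord0 i| <= 2) /\ `|w.2| <= 1.
Proof.
move=> [/= H1 H2]; split => [i|]; last by move: H2; rewrite in_itv/= -ler_norml.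
by have := H1 i; rewrite ler_norml /atom_lo /atom_hi; case: ifP => _; lra.
Qed.

Lemma atom_bounded w : atom w != 0 -> (forall i, `|w.1 ord0 i| <= 2) /\ `|w.2| <= 1.
Proof.
case/atom_neq0 => /atom_box_bounded// [H1 H2]; split => // i.
by have := H1 i; rewrite mxE; case: ifP; rewrite ?normrN.
Qed.

Definition atom_mass : R := fine (mu atom_box).

Lemma hmeasure_atom_boxE :
  (@hmeasure R n.+1 : {measure set V -> \bar R}) atom_box = atom_mass%:E.
Proof.
have [m _ E] := hmeasure_atom_box.
have -> : atom_mass = m by rewrite /atom_mass E.
exact: E.
Qed.

Lemma atom_mass_gt0 : 0 < atom_mass.
Proof. by have [m m0 E] := hmeasure_atom_box; rewrite /atom_mass E. Qed.

Lemma integral_atom_bound (c : R) : 0 <= c ->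
  (\int[mu]_w (c * (\1_atom_box w + \1_atom_box (heis_flip w)))%:E =
   (c * (2 * atom_mass))%:E)%E.
Proof.
move=> c0; have mB := @measurable_indic _ _ R setT _ measurable_atom_box.
have mBE : measurable_fun setT (fun w => (\1_atom_box w)%:E : \bar R).
  exact/measurable_EFinP.
have mF : measurable_fun setT (fun w => (\1_atom_box (heis_flip w))%:E : \bar R).
  apply/measurable_EFinP.
  apply: (@measurableT_comp _ _ _ _ _ _ (\1_atom_box : V -> R)) => //.
  by have [] := heis_flip_preserving.
under eq_integral do rewrite EFinM EFinD.
rewrite ge0_integralZl_EFin//; last first.
- exact: emeasurable_funD.
- by move=> w _; rewrite adde_ge0// lee_fin.
rewrite ge0_integralD//.
rewrite (ge0_integral_preserving heis_flip_preserving mBE); last first.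
  by move=> w; rewrite lee_fin.
rewrite integral_indic//; last exact: measurable_atom_box.
rewrite setIT hmeasure_atom_boxE -EFinD -EFinM.
by congr (_%:E); ring.
Qed.

Lemma integrable_mul_atom (h : V -> R) (B : R) : measurable_fun setT h ->
  (forall w, `|h w| <= B) -> mu.-integrable setT (fun w => (h w * atom w)%:E).
Proof.
move=> mh hB; have B0 : 0 <= B by exact: le_trans (hB 0).
apply/integrableP; split.
  by apply/measurable_EFinP; apply: measurable_funM => //; exact: measurable_atom.
apply: (@le_lt_trans _ _
  (\int[mu]_w (B * (\1_atom_box w + \1_atom_box (heis_flip w)))%:E)%E).
  apply: ge0_le_integralT => w; first exact: abse_ge0.
  rewrite abse_EFin lee_fin normrM.
  by apply: ler_pM => //; exact: normr_atom_le.
by rewrite integral_atom_bound// ltry.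
Qed.

(** Since the atom is odd, twice the integral is, up to sign, that of
    [(h (heis_flip w) - h w) * atom w]. The support has measure at most [2 * atom_mass], and the
    factors 2 cancel. *)
Lemma Rintegral_mul_atom_le (h : V -> R) (B D : R) : measurable_fun setT h ->
  (forall w, `|h w| <= B) -> 0 <= D ->
  (forall w, atom w != 0 -> `|h (heis_flip w) - h w| <= D) ->
  `|Rintegral mu setT (fun w => h w * atom w)| <= D * atom_mass.
Proof.
move=> mh hB D0 hD.
have mf : measurable_fun setT heis_flip by have [] := heis_flip_preserving.
have ih := integrable_mul_atom mh hB.
have mh' : measurable_fun setT (fun w => h (heis_flip w)) by exact: measurableT_comp mf.
have ih' : mu.-integrable setT (fun w => (h (heis_flip w) * atom w)%:E).
  by apply: (integrable_mul_atom mh') => w; exact: hB.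
have E : Rintegral mu setT (fun w => h (heis_flip w) * atom w) =
       - Rintegral mu setT (fun w => h w * atom w).
  rewrite /Rintegral -[in RHS](integral_preserving heis_flip_preserving); last first.
    by apply: measurable_funM => //; exact: measurable_atom.
  under [in RHS]eq_integral do rewrite atom_flip mulrN EFinN.
  by rewrite integralN ?fineN ?opprK//; exact: integrable_add_def.
have : `|Rintegral mu setT (fun w => h (heis_flip w) * atom w - h w * atom w)| <=
    2 * (D * atom_mass).
  apply: (@normr_RintegralT_le _ _ _ _ _
    (fun w => (D * (\1_atom_box w + \1_atom_box (heis_flip w)))%:E)).
    move=> w; rewrite lee_fin -mulrBl normrM.
    have [->|a0] := eqVneq (atom w) 0.
      by rewrite normr0 mulr0 mulr_ge0// addr_ge0// indicE.
    by apply: ler_pM => //; [exact: hD|exact: normr_atom_le].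
  by rewrite integral_atom_bound// lee_fin; lra.
rewrite RintegralB// E -opprD normrN -mulr2n normrMn mulr2n; lra.
Qed.

End atom.

(** * The grand maximal function of the atom *)

Section atom_H1.
Context (R : realType) (n : nat).
Local Notation V := (heis R n.+1).
Local Notation mu := (@hmeasure R n.+1).
Local Notation Q := (hdim n.+1).

Lemma hnorm_le_double (x : V) (a : R) : 1 <= a ->
  enorm x.1 ^+ 2 <= a -> `|x.2| <= a -> hnorm x <= 2 * a.
Proof.
move=> a1 xa sa; apply: le_hnorm; first lra.
have h1 : enorm x.1 ^+ 4 <= a ^+ 2.
  by rewrite [leLHS](exprM _ 2 2); apply: lerXn2r; rewrite ?nnegrE ?sqr_ge0 //; lra.
have h2 : x.2 ^+ 2 <= a ^+ 2.
  by rewrite -(real_normK (num_real x.2)) ler_pXn2r ?nnegrE//; lra.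
apply: le_trans (lerD h1 h2) _.
have : 1 <= a ^+ 2 by rewrite expr_ge1//; lra.
set b := a ^+ 2 => b1.
have -> : (2 * a) ^+ 4 = 16 * (b * b) by rewrite /b; ring.
nra.
Qed.

(** On the support |z|^2 is at most 8 (n + 1) and the flip moves a point by at most 4, so the
    central shift is at most 8 (n + 1) + 16, hence at most 24 (n + 1). *)
Definition atom_radius : R := 24 * n.+1%:R.

Lemma atom_radius_ge24 : 24 <= atom_radius.
Proof. by rewrite /atom_radius ler_pMr// ler1n. Qed.

Definition axis0 : option 'I_(n.+1 + n.+1) := Some (lshift n.+1 ord0).

(** The horizontal step from [hinv w] also changes the central coordinate through the group law;
    this amount restores it. *)
Definition flip_shift (w : V) : R :=
  2 * complex.Im (hdot w.1
    ((2 * w.1 ord0 ord0) *: (delta_mx ord0 (lshift n.+1 ord0) : Cn R n.+1))).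

Lemma hinv_flip (w : V) : hinv (heis_flip w) =
  hmul (hmul (hinv w) ((2 * w.1 ord0 ord0) *: hbasis R axis0))
    (flip_shift w *: hbasis R None).
Proof.
rewrite /hinv /hmul/= scaler0 Im_hdot0r mulr0 !addr0; congr pair.
  apply/rowP => j; rewrite !mxE/= ?eqxx /=.
  have -> : (j == lshift n.+1 ord0) = (j == ord0) by rewrite -!val_eqE.
  by case: eqP => [->|_]; rewrite /= ?mulr1n ?mulr0n !(ord1 ord0); ring.
rewrite /flip_shift Im_hdotNl.
by rewrite /GRing.scale/=; ring.
Qed.

Lemma enorm_sqr_le_coord (z : Cn R n.+1) (c : R) : (forall i, `|z ord0 i| <= c) ->
  enorm z ^+ 2 <= 2 * c ^+ 2 * n.+1%:R.
Proof.
move=> zc; rewrite enorm_sqr; apply: (@le_trans _ _ (\sum_(i < n.+1 + n.+1) c ^+ 2)).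
  apply: ler_sum => i _; have := zc i; rewrite -(real_normK (num_real (z _ _))).
  by have := normr_ge0 (z ord0 i); nra.
by rewrite sumr_const card_ord -[_ *+ _]mulr_natr natrD; lra.
Qed.

Lemma enorm_delta (a : R) i : enorm (a *: delta_mx ord0 i : Cn R n.+1) ^+ 2 = a ^+ 2.
Proof.
rewrite enorm_sqr (bigD1 i)//= big1 ?addr0 => [|j ji]; rewrite !mxE !eqxx ?mulr1//=.
by rewrite (negbTE ji) mulr0 expr0n.
Qed.

Lemma flip_shift_le (w : V) : (forall i, `|w.1 ord0 i| <= 2) ->
  `|flip_shift w| <= atom_radius.
Proof.
move=> w2; rewrite /flip_shift normrM (ger0_norm (x := 2))//.
have := Im_hdot_le w.1
  ((2 * w.1 ord0 ord0) *: (delta_mx ord0 (lshift n.+1 ord0) : Cn R n.+1)).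
rewrite enorm_delta; have := enorm_sqr_le_coord w2.
have : (2 * w.1 ord0 ord0) ^+ 2 <= 16.
  rewrite exprMn -(real_normK (num_real (w.1 ord0 ord0))).
  by have := w2 ord0; have := normr_ge0 (w.1 ord0 ord0); nra.
have : (1 : R) <= n.+1%:R by rewrite ler1n.
rewrite /atom_radius; set a := complex.Im _; set b := enorm _ ^+ 2.
set c := _ ^+ 2; set m := n.+1%:R.
lra.
Qed.

Lemma hnorm_atom_radius (w : V) : (forall i, `|w.1 ord0 i| <= 2) -> `|w.2| <= 1 ->
  hnorm w <= 2 * atom_radius.
Proof.
move=> w1 w2; have r24 := atom_radius_ge24; apply: hnorm_le_double; [lra| |lra].
apply: le_trans (enorm_sqr_le_coord w1) _.
by rewrite /atom_radius; have : (0 : R) <= n.+1%:R by []; lra.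
Qed.

Lemma hnorm_axis0 (s : R) : `|s| <= 4 -> hnorm (s *: hbasis R axis0) <= 2 * atom_radius.
Proof.
move=> s4; have r24 := atom_radius_ge24; apply: hnorm_le_double; first lra.
  rewrite enorm_delta -(real_normK (num_real s)).
  by have := normr_ge0 s; nra.
by rewrite /= scaler0 normr0; lra.
Qed.

Lemma hnorm_center (s : R) : `|s| <= atom_radius ->
  hnorm (s *: hbasis R None : V) <= 2 * atom_radius.
Proof.
move=> s4; have r24 := atom_radius_ge24; apply: hnorm_le_double; first lra.
  rewrite /= scaler0 enorm_sqr big1; first lra.
  by move=> i _; rewrite mxE expr0n.
change (`|s * 1| <= atom_radius); by rewrite mulr1.
Qed.

(** Two uses of the quasi-triangle inequality give |x| <= 2 t + 4 |y q| + 4 |q|, and the last term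
    is at most |x| / 2. The bound on [q] covers all points on the two steps from [hinv w] to the
    inverse of the flipped point. *)
Lemma hnorm_far (x y q : V) (t : R) : hnorm (hmul y (hinv x)) < t ->
  hnorm q <= 20 * atom_radius -> 160 * atom_radius <= hnorm x ->
  hnorm x / 8 <= t + hnorm (hmul y q).
Proof.
move=> yx qr xr.
have h1 : hnorm x <= 2 * (t + hnorm y).
  have {1}-> : x = hmul (hinv (hmul y (hinv x))) y by rewrite hinvM hinvK hmulVK.
  apply: le_trans (hnormM _ _) _; rewrite hnormV; lra.
have h2 : hnorm y <= 2 * (hnorm (hmul y q) + hnorm q).
  rewrite -{1}(hmulKV y q); apply: le_trans (hnormM _ _) _.
  by rewrite hnormV.
have := hnorm_ge0 (hmul y (hinv x)); lra.
Qed.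

(** By [hinv_flip] the two points differ by a horizontal and a central step. The central one gives
    the better exponent Q + 2, lowered to Q + 1 because [X] is at least 1. *)
Lemma hscale_flip_le (psi : V -> R) (x y w : V) (t : R) : test_component psi ->
  0 < t -> hnorm (hmul y (hinv x)) < t -> 160 * atom_radius <= hnorm x -> atom w != 0 ->
  `|hscale t psi (hmul y (hinv (heis_flip w))) - hscale t psi (hmul y (hinv w))| <=
  (4 + atom_radius) / (hnorm x / 8) ^+ Q.+1.
Proof.
move=> tpsi t0 yx xr /atom_bounded[w1 w2].
have r24 := atom_radius_ge24.
set X := hnorm x / 8; have X1 : 1 <= X by rewrite /X ler_pdivlMr//; lra.
have X0 : 0 < X by lra.
pose a := 2 * w.1 ord0 ord0; pose b := flip_shift w.
have a4 : `|a| <= 4 by rewrite normrM ger0_norm//; have := w1 ord0; lra.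
have bA : `|b| <= atom_radius by exact: flip_shift_le.
have wr := hnorm_atom_radius w1 w2.
have q1 s : `|s| <= `|a| -> hnorm (hmul (hinv w) (s *: hbasis R axis0)) <= 8 * atom_radius.
  move=> sa; apply: le_trans (hnormM _ _) _; rewrite hnormV.
  have := hnorm_axis0 (le_trans sa a4); lra.
set u := hmul y (hinv w); set u1 := hmul u (a *: hbasis R axis0).
have -> : hmul y (hinv (heis_flip w)) = hmul u1 (b *: hbasis R None).
  by rewrite hinv_flip -!hmulA.
have s1 : `|hscale t psi u1 - hscale t psi u| <= `|a| / X ^+ (Q + 1).
  apply: (@hscale_step_le _ _ _ axis0) => // s sa.
  rewrite hmulA; apply: hnorm_far => //; apply: le_trans (q1 s sa) _; lra.
have s2 : `|hscale t psi (hmul u1 (b *: hbasis R None)) - hscale t psi u1| <=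
    `|b| / X ^+ (Q + 2).
  apply: (@hscale_step_le _ _ _ None) => // s sb.
  rewrite /u1 /u !hmulA; apply: hnorm_far => //; rewrite -hmulA.
  apply: le_trans (hnormM _ _) _; have := q1 a (lexx _).
  have := hnorm_center (le_trans sb bA); lra.
have s2' : `|b| / X ^+ (Q + 2) <= `|b| / X ^+ Q.+1.
  apply: ler_wpM2l => //; rewrite lef_pV2 ?posrE ?exprn_gt0//.
  by apply: ler_weXn2l => //; rewrite addn2.
rewrite addn1 in s1.
have -> : hscale t psi (hmul u1 (b *: hbasis R None)) - hscale t psi u =
  (hscale t psi u1 - hscale t psi u) +
  (hscale t psi (hmul u1 (b *: hbasis R None)) - hscale t psi u1) by ring.
apply: le_trans (ler_normD _ _) _.
apply: le_trans (lerD s1 (le_trans s2 s2')) _.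
rewrite -mulrDl; apply: ler_wpM2r; last lra.
by rewrite invr_ge0 exprn_ge0// ltW.
Qed.

(** The first term serves bounded x, where the decay is at least a constant; the second serves large
    x, where |x| / 8 is at least (1 + |x|) / 16. *)
Definition test_const : R :=
  decay_const R n.+1 * (1 + 160 * atom_radius) ^+ Q.+1 +
  (4 + atom_radius) * atom_mass R n * 16 ^+ Q.+1.

Lemma measurable_hscale (psi : V -> R) (t : R) y : test_component psi ->
  measurable_fun setT (fun w => hscale t psi (hmul y (hinv w))).
Proof.
move=> [spsi _ _]; apply: measurable_funM => //.
apply: (measurableT_comp (continuous_heis_measurable (fun x => (spsi [::] x I).1))).
exact: (measurableT_comp (@measurable_hdil _ _ _) (measurable_hmulV y)).
Qed.

Lemma hscale_atom_le (psi : V -> R) (x y : V) (t : R) : test_component psi ->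
  0 < t -> hnorm (hmul y (hinv x)) < t ->
  `|Rintegral mu setT (fun w => hscale t psi (hmul y (hinv w)) * atom w)| <=
  test_const * ((1 + hnorm x) ^+ Q.+1)^-1.
Proof.
move=> tpsi t0 yx; have r24 := atom_radius_ge24; have x0 := hnorm_ge0 x.
have D0 := decay_const_ge0 R n.+1; have m0 := atom_mass_gt0 R n.
have p0 : 0 < (1 + hnorm x) ^+ Q.+1 by rewrite exprn_gt0//; lra.
have t1 : 0 <= decay_const R n.+1 * (1 + 160 * atom_radius) ^+ Q.+1.
  by rewrite mulr_ge0// exprn_ge0//; lra.
have t2 : 0 <= (4 + atom_radius) * atom_mass R n * 16 ^+ Q.+1.
  by rewrite mulr_ge0 ?exprn_ge0// mulr_ge0 ?(ltW m0)//; lra.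
have [xs|xl] := leP (hnorm x) (160 * atom_radius).
  (* For bounded x no cancellation is used: the atom is at most 1 in size, and the L^1 norm of the
     dilate is at most [decay_const] for every [t]. *)
  apply: (@le_trans _ _ (decay_const R n.+1)).
    apply: (@normr_RintegralT_le _ _ _ _ _ (fun w => ((t ^+ Q)^-1 *
        ((1 + hnorm (hmul y (hinv w)) / t) ^+ Q.+1)^-1)%:E)) => [w|].
      rewrite lee_fin normrM; apply: le_trans (hscale_size_le _ tpsi t0).
      by rewrite ler_piMr// normr_atom_le1.
    apply: le_trans (decay_integral_le _ _ t0) _.
      by rewrite invr_ge0 exprn_ge0// ltW.
    by rewrite mulVf ?mulr1// gt_eqF// exprn_gt0.
  rewrite ler_pdivlMr//.
  apply: (@le_trans _ _ (decay_const R n.+1 * (1 + 160 * atom_radius) ^+ Q.+1)).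
    by apply: ler_wpM2l => //; apply: lerXn2r; rewrite ?nnegrE; lra.
  by rewrite /test_const lerDl.
have X0 : 0 < hnorm x / 8 by lra.
(* For large x the oddness of the atom replaces the dilate by its difference at reflected points. *)
have := @Rintegral_mul_atom_le _ _
  (fun w => hscale t psi (hmul y (hinv w))) ((t ^+ Q)^-1)
  ((4 + atom_radius) / (hnorm x / 8) ^+ Q.+1) (measurable_hscale _ _ tpsi).
have -> : (4 + atom_radius) / (hnorm x / 8) ^+ Q.+1 * atom_mass R n =
  ((4 + atom_radius) * atom_mass R n) * ((hnorm x / 8) ^+ Q.+1)^-1 by ring.
move=> H; apply: le_trans (H _ _ _) _ => {H}.
- move=> w; apply: le_trans (hscale_size_le _ tpsi t0) _.
  rewrite ler_piMr// ?invr_ge0 ?exprn_ge0 ?(ltW t0)//.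
  by rewrite invf_le1 ?exprn_gt0 ?exprn_ege1// ?ltr_pwDl ?lerDl ?divr_ge0 ?hnorm_ge0 ?ltW.
- by rewrite divr_ge0 ?exprn_ge0//; lra.
- by move=> w aw; apply: hscale_flip_le => //; exact: ltW.
have -> : test_const * ((1 + hnorm x) ^+ Q.+1)^-1 =
  decay_const R n.+1 * (1 + 160 * atom_radius) ^+ Q.+1 *
    ((1 + hnorm x) ^+ Q.+1)^-1 +
  (4 + atom_radius) * atom_mass R n * (16 ^+ Q.+1 * ((1 + hnorm x) ^+ Q.+1)^-1).
  by rewrite /test_const; ring.
rewrite ler_wpDl//; first by rewrite mulr_ge0// invr_ge0 ltW.
apply: ler_wpM2l; first by rewrite mulr_ge0//; lra.
rewrite -[leLHS]exprVn -[X in _ <= _ * X]exprVn -exprMn; apply: lerXn2r; rewrite ?nnegrE.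
- by rewrite invr_ge0 ltW.
- by rewrite mulr_ge0// invr_ge0; lra.
- rewrite ler_pdivlMr; last lra.
  by rewrite mulrC ler_pdivrMr//; lra.
Qed.

Definition atomC (w : V) : R[i] := (atom w)%:C.

Lemma grand_maximal_atom_le x :
  (grand_maximal atomC x <= (2 * test_const * ((1 + hnorm x) ^+ Q.+1)^-1)%:E)%E.
Proof.
apply: ge_ereal_sup => _ [phi [t [y [FS t0 yx ->]]]]; rewrite lee_fin.
have [tRe tIm] := FS_normalized_components FS.
apply: le_trans (normc_le _) _.
(* The factor 2 is shared between the real and the imaginary part of the test function. *)
rewrite -mulrA mulr_natl mulr2n.
apply: lerD.
  apply: le_trans (hscale_atom_le tRe t0 yx); rewrite le_eqVlt; apply/orP; left; apply/eqP.
  congr (`|_|); rewrite /hconv /cintegral/=; apply: eq_Rintegral => w _.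
  by rewrite /hdilate /hscale /atomC; case: (phi _) => a b /=; ring.
apply: le_trans (hscale_atom_le tIm t0 yx); rewrite le_eqVlt; apply/orP; left; apply/eqP.
congr (`|_|); rewrite /hconv /cintegral/=; apply: eq_Rintegral => w _.
by rewrite /hdilate /hscale /atomC; case: (phi _) => a b /=; ring.
Qed.

Lemma test_const_ge0 : 0 <= test_const.
Proof.
have r24 := atom_radius_ge24; have m0 := atom_mass_gt0 R n.
rewrite addr_ge0// mulr_ge0 ?decay_const_ge0 ?exprn_ge0//; first lra.
by rewrite mulr_ge0 ?(ltW m0)//; lra.
Qed.

Lemma H1_atom : H1 atomC.
Proof.
split; first split.
- have := @integrable_mul_atom R n (fun=> 1) 1 (measurable_cst _)
    (fun=> ltac:(by rewrite normr1)).
  by under eq_fun do rewrite mul1r.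
- exact: integrable0.
have C0 : 0 <= 2 * test_const by rewrite mulr_ge0// test_const_ge0.
rewrite /H1norm; apply: (@le_lt_trans _ _
  (\int[mu]_x (2 * test_const * ((1 + hnorm x) ^+ Q.+1)^-1)%:E)%E).
  apply: le_integralT => x; last exact: grand_maximal_atom_le.
  by rewrite lee_fin mulr_ge0// invr_ge0 exprn_ge0// addr_ge0// hnorm_ge0.
(* With centre 0 and [t] equal to 1, |0 w^-1| = |w|, and the bound is the required one. *)
have := @decay_integral_le R n.+1 0 (2 * test_const) 1 C0 ltr01.
have -> : (fun w => (2 * test_const *
      ((1 + hnorm (hmul (0 : V) (hinv w)) / 1) ^+ Q.+1)^-1)%:E : \bar R) =
  (fun x => (2 * test_const * ((1 + hnorm x) ^+ Q.+1)^-1)%:E).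
  apply/funext => w; rewrite divr1 -(hnormV w); congr (_ * ((1 + hnorm _) ^+ _)^-1)%:E.
  by rewrite hmul0l.
by move=> H; exact: le_lt_trans H (ltry _).
Qed.

End atom_H1.

(** * The kernel applied to the atom *)

Section kernel_lower_bound.
Context (R : realType) (n : nat).
Local Notation V := (heis R n.+1).
Local Notation mu := (@hmeasure R n.+1).
Local Notation i1 := (rshift n.+1 (@ord0 n)).
Local Notation K := (flag_kernel (@omega R n)).

(** The imaginary part of 1 / (|z|^2 + i t) is - t / (|z|^4 + t^2). One of the n + 2 factors |z|^2
    comes from the homogeneous extension of [omega]. *)
Lemma Im_flag_kernel (p : V) : complex.Im (K p) =
  - (p.1 ord0 ord0 * p.1 ord0 i1 * p.2) /
  ((enorm p.1 ^+ 2) ^+ n.+2 * ((enorm p.1 ^+ 2) ^+ 2 + p.2 ^+ 2)).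
Proof.
have Im_scale (a : R) (w : R[i]) : complex.Im (a%:C * w) = a * complex.Im w.
  by case: w => b c /=; ring.
rewrite /flag_kernel hom0_omega exprM [_ ^+ n.+2]exprS -fmorphV -rmorphM.
rewrite Im_scale /= !invfM.
by ring.
Qed.

(* On this box the first coordinate lies in the gap between the two halves of
   the atom, and the imaginary part of z_1 lies above its support, so both
   factors of Omega(z - eta) have a known sign. *)
Definition far_lo (i : 'I_(n.+1 + n.+1)) : R :=
  if i == ord0 then - 2^-1 else if i == i1 then 2 else 0.
Definition far_hi (i : 'I_(n.+1 + n.+1)) : R :=
  if i == ord0 then 2^-1 else if i == i1 then 3 else 1.
Definition far_base : set 'rV[R]_(n.+1 + n.+1) :=
  [set v | forall i, far_lo i <= v ord0 i <= far_hi i].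

(** Differences of coordinates are at most 5, so |z - eta|^2 is at most 2 * 25 (n + 1). The same
    number bounds the change of the central coordinate. *)
Definition far_scale : R := 50 * n.+1%:R.

Lemma i1_neq0 : (i1 == ord0 :> 'I_(n.+1 + n.+1)) = false.
Proof. by []. Qed.

Lemma far_base_bounded v : far_base v -> forall i, `|v ord0 i| <= 3.
Proof.
move=> vB i; have := vB i; rewrite /far_lo /far_hi ler_norml.
by case: ifP => _; [lra|case: ifP => _; lra].
Qed.

(** On the half where the atom is 1 the difference is at most 1/2 - 1, and on the half where it is
    -1 at least -1/2 + 1. *)
Lemma atom_sign (v : 'rV[R]_(n.+1 + n.+1)) (y : V) : far_base v -> atom y != 0 ->
  (v ord0 ord0 - y.1 ord0 ord0) * atom y <= - 2^-1.
Proof.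
move=> /(_ ord0); rewrite /far_lo /far_hi eqxx => v0 /atom_neq0[yB|yB].
  rewrite /atom !indicE mem_set// memNset; last exact: atom_box_flip.
  by have [/(_ ord0)] := yB; rewrite /atom_lo /atom_hi eqxx/=; lra.
have := atom_box_flip yB; rewrite heis_flipK => yB'.
rewrite /atom !indicE (memNset yB') (mem_set yB).
by have [/(_ ord0)] := yB; rewrite /atom_lo /atom_hi !mxE eqxx/=; lra.
Qed.

Lemma atom_i1 (y : V) : atom y != 0 -> `|y.1 ord0 i1| <= 1.
Proof.
case/atom_neq0 => -[/(_ i1) + _]; rewrite /atom_lo /atom_hi ?mxE i1_neq0 ler_norml; lra.
Qed.

(** The numerator is at least (1/2)(t/2) and the denominator at most 5 t^2 times the power of
    [far_scale]. *)
Definition kernel_const : R := (20 * far_scale ^+ n.+2)^-1.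

(** For such [t] the central coordinate of the argument stays in [t / 2, 2 t], and all factors have
    a fixed sign. The upper bound serves to make the integral finite. *)
Lemma Im_kernel_atom_bounds (v : 'rV[R]_(n.+1 + n.+1)) (t : R) (y : V) : far_base v ->
  2 * far_scale <= t -> atom y != 0 ->
  kernel_const / t <= complex.Im (K (hmul (v, t) (hinv y)) * (atomC y)) <= 25.
Proof.
move=> vB tM a0; rewrite /atomC.
have n1 : (1 : R) <= n.+1%:R by rewrite ler1n.
have -> (z : R[i]) (a : R) : complex.Im (z * a%:C) = complex.Im z * a.
  by case: z => b c /=; ring.
rewrite Im_flag_kernel.
have [y1 y2] := atom_bounded a0.
have v3 := far_base_bounded vB.
set p := hmul _ _.
have p1 i : p.1 ord0 i = v ord0 i - y.1 ord0 i by rewrite /p/= !mxE.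
have p5 i : `|p.1 ord0 i| <= 5.
  by rewrite p1; apply: le_trans (ler_normB _ _) _; have := v3 i; have := y1 i; lra.
have EM : enorm p.1 ^+ 2 <= far_scale.
  by apply: le_trans (enorm_sqr_le_coord p5) _; rewrite /far_scale; lra.
have d1 : 1 <= p.1 ord0 i1 <= 5.
  have := p5 i1; have := vB i1; have := atom_i1 a0; rewrite p1 /far_lo /far_hi i1_neq0 eqxx.
  rewrite !ler_norml; lra.
have E1 : 1 <= enorm p.1 ^+ 2.
  have := enorm_coord p.1 i1; have := enorm_ge0 p.1; have := ler_norm (p.1 ord0 i1).
  nra.
have d0 : p.1 ord0 ord0 * atom y <= - 2^-1 by rewrite p1; exact: atom_sign.
have d0' : - 5 <= p.1 ord0 ord0 * atom y.
  have : `|p.1 ord0 ord0 * atom y| <= 5 * 1.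
    by rewrite normrM; apply: ler_pM => //; exact: normr_atom_le1.
  by rewrite ler_norml; lra.
have tau : `|p.2 - t| <= far_scale.
  have -> : p.2 - t = - y.2 - 2 * complex.Im (hdot v y.1).
    by rewrite /p/= Im_hdotNr; ring.
  have := Im_hdot_le v y.1; have := enorm_sqr_le_coord v3.
  have := enorm_sqr_le_coord y1; rewrite /far_scale.
  move: y2; rewrite !ler_norml; lra.
(* What remains is an inequality between real numbers: [q0] and [q1] are the factors of Omega, [tau]
   is the central coordinate and [e] is |p.1|^2. *)
move: (p.1 ord0 ord0) (p.1 ord0 i1) p.2 (enorm p.1 ^+ 2) (atom y)
  d0 d0' d1 tau E1 EM => q0 q1 tau e a.
move: tM; rewrite /kernel_const; set M := far_scale.
move=> tM qa1 qa2 /andP[q1l q1u] tauM e1 eM.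
have [tl tu] : t / 2 <= tau /\ tau <= 2 * t.
  by move: tauM; rewrite ler_norml; split; lra.
have M1 : 1 <= M by lra.
have -> : - (q0 * q1 * tau) / (e ^+ n.+2 * (e ^+ 2 + tau ^+ 2)) * a =
   (- (q0 * a)) * q1 * tau / (e ^+ n.+2 * (e ^+ 2 + tau ^+ 2)) by ring.
set b := - (q0 * a); have [bl bu] : 2^-1 <= b /\ b <= 5 by rewrite /b; lra.
have bq : 2^-1 <= b * q1 <= 25 by apply/andP; split; nra.
have tau1 : 1 <= tau by lra.
have en1 : 1 <= e ^+ n.+2 by rewrite exprn_ege1.
have enM : e ^+ n.+2 <= M ^+ n.+2 by apply: lerXn2r; rewrite ?nnegrE; lra.
have D0 : 0 < e ^+ n.+2 * (e ^+ 2 + tau ^+ 2).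
  by apply: mulr_gt0; [lra|nra].
apply/andP; split.
  have P0 : 0 < M ^+ n.+2 by apply: lt_le_trans enM; lra.
  have t0 : 0 < t by lra.
  have S : e ^+ n.+2 * (e ^+ 2 + tau ^+ 2) <= M ^+ n.+2 * (5 * t ^+ 2).
    apply: ler_pM => //; [lra|nra|].
    have : e ^+ 2 <= t ^+ 2 by apply: lerXn2r; rewrite ?nnegrE; lra.
    have : tau ^+ 2 <= (2 * t) ^+ 2 by apply: lerXn2r; rewrite ?nnegrE; lra.
    by rewrite exprMn; lra.
  rewrite ler_pdivlMr//.
  apply: (@le_trans _ _ ((20 * M ^+ n.+2)^-1 / t * (M ^+ n.+2 * (5 * t ^+ 2)))).
    apply: ler_wpM2l S; apply: divr_ge0; last exact: ltW.
    by rewrite invr_ge0; apply: mulr_ge0 => //; exact: ltW.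
  have -> : (20 * M ^+ n.+2)^-1 / t * (M ^+ n.+2 * (5 * t ^+ 2)) = 4^-1 * t.
    by field; rewrite (gt_eqF t0) (gt_eqF P0).
  by move/andP: bq => [? _]; nra.
rewrite ler_pdivrMr//.
apply: (@le_trans _ _ (25 * tau)); first by apply: ler_wpM2r; lra.
apply: ler_wpM2l => //.
apply: (@le_trans _ _ (1 * (e ^+ 2 + tau ^+ 2))); first nra.
by apply: ler_wpM2r => //; nra.
Qed.

End kernel_lower_bound.

(** * The lower bound c / t for the convolution *)

Section lower_integral.
Context (R : realType) (n : nat).
Local Notation V := (heis R n.+1).
Local Notation mu := (@hmeasure R n.+1).
Local Notation K := (flag_kernel (@omega R n)).
Local Notation far_base := (@far_base R n).
Local Notation far_scale := (far_scale R n).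
Local Notation kernel_const := (kernel_const R n).

Lemma kernel_const_gt0 : 0 < kernel_const.
Proof. by rewrite invr_gt0 mulr_gt0// exprn_gt0// mulr_gt0// ltr0n. Qed.

(** The integrand is nonnegative, so the half [atom_box] of the support suffices for the lower
    bound; the upper bound on the integrand makes [Rintegral] the true integral. *)
Lemma Im_hconv_atom_ge (v : 'rV[R]_(n.+1 + n.+1)) (t : R) : far_base v ->
  2 * far_scale <= t ->
  kernel_const * atom_mass R n / t <= complex.Im (hconv K (@atomC R n) (v, t) : R[i]).
Proof.
move=> vB tM.
have t0 : 0 < t.
  by apply: lt_le_trans tM; rewrite mulr_gt0// mulr_gt0// ltr0n.
have kt0 : 0 <= kernel_const / t by rewrite divr_ge0 ?(ltW t0) ?(ltW kernel_const_gt0).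
pose h (y : V) := complex.Im (K (hmul (v, t) (hinv y)) * atomC y).
rewrite /hconv /cintegral /= -/h.
have h0 y : atom y = 0 -> h y = 0.
  by move=> a0; rewrite /h /atomC a0 mulr0.
have hge0 y : 0 <= h y.
  have [/h0 ->//|a0] := eqVneq (atom y) 0.
  by have /andP[h1 _] := Im_kernel_atom_bounds vB tM a0; exact: le_trans h1.
pose b (y : V) : R := \1_(@atom_box R n) y + \1_(@atom_box R n) (heis_flip y).
have hle y : ((h y)%:E <= (25 * b y)%:E)%E.
  rewrite lee_fin; have [a0|a0] := eqVneq (atom y) 0.
    by rewrite h0// mulr_ge0// /b addr_ge0// indicE.
  have /andP[_ h2] := Im_kernel_atom_bounds vB tM a0; apply: le_trans h2 _.
  rewrite ler_pMr// /b !indicE; case: (atom_neq0 a0) => /mem_set -> /=.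
    by rewrite lerDl.
  by rewrite lerDr.
have Ib : (\int[mu]_y (25 * b y)%:E <= (25 * (2 * atom_mass R n))%:E)%E.
  by rewrite integral_atom_bound.
have hI := ge0_le_RintegralT hge0 hle Ib.
rewrite -lee_fin -hI.
apply: (@le_trans _ _
  (\int[mu]_y ((kernel_const / t)%:E * (\1_(@atom_box R n) y)%:E))%E).
  rewrite ge0_integralZl_EFin//; last first.
  - by apply/measurable_EFinP; exact: (measurable_indic (@measurable_atom_box R n)).
  rewrite integral_indic//; last exact: (@measurable_atom_box R n).
  by rewrite setIT hmeasure_atom_boxE -EFinM lee_fin mulrAC.
apply: ge0_le_integralT => y; first by rewrite mule_ge0// lee_fin.
rewrite -EFinM lee_fin indicE; case: (boolP (y \in _)) => [yB|_]; last by rewrite mulr0.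
have a0 : atom y != 0.
  rewrite /atom !indicE yB memNset ?subr0 ?oner_eq0//.
  by apply: atom_box_flip; exact: set_mem.
by rewrite mulr1; have /andP[] := Im_kernel_atom_bounds vB tM a0.
Qed.

End lower_integral.

(** * Divergence of the integral of 1 / t *)

Section divergence.
Context (R : realType) (n : nat).
Local Notation V := (heis R n).
Local Notation mu := (@hmeasure R n).

Lemma lebesgue_measure_co (a b : R) : a <= b ->
  lebesgue_measure (`[a, b[%classic : set R) = (b - a)%:E.
Proof.
rewrite le_eqVlt => /predU1P[->|ab].
  by rewrite set_itv_ge ?measure0 ?subrr// bnd_simp ltxx.
by rewrite lebesgue_measure_itv/= lte_fin ab.
Qed.

Lemma ae_sub (P P' : V -> Prop) : {ae mu, forall x, P x} ->
  (forall x, P x -> P' x) -> {ae mu, forall x, P' x}.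
Proof.
move=> [A [mA A0 sA]] PP'; exists A; split => //.
by apply: subset_trans sA; apply: subsetC => x; exact: PP'.
Qed.

(* The integral of 1 / t over [2^k s, 2^(k+1) s] is at least 1 / 2. *)
Lemma integral_inv_ge (B : set 'rV[R]_(n + n)) (b c s : R) (F : V -> R) (N : nat) :
  measurable B -> lebesgue_rV R (n + n) B = b%:E -> 0 <= c -> 0 < s ->
  measurable_fun setT F -> (forall x, 0 <= F x) ->
  {ae mu, forall x, B x.1 -> s <= x.2 -> c / x.2 <= F x} ->
  ((N%:R * (c * b / 2))%:E <= \int[mu]_x (F x)%:E)%E.
Proof.
move=> mB Bb c0 s0 mF F0 cF.
pose W k : set V := B `*` `[2 ^+ k * s, 2 ^+ k.+1 * s[%classic.
(* A lower bound of c / t on the k-th slab; times the measure b 2^k s it gives c b / 2. *)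
pose a k := c / (2 ^+ k.+1 * s).
pose g N x := \sum_(k < N) a k * \1_(W k) x.
have ks k : 0 < 2 ^+ k * s by rewrite mulr_gt0// exprn_gt0.
have a0 k : 0 <= a k by rewrite divr_ge0// ltW.
have mW k : measurable (W k) by apply: measurableX => //; exact: measurable_itv.
have muW k : (mu : {measure set V -> \bar R}) (W k) = (b * (2 ^+ k * s))%:E.
  pose I : set R := `[2 ^+ k * s, 2 ^+ k.+1 * s[%classic.
  transitivity (lebesgue_rV R (n + n) B * lebesgue_measure I)%E.
    by apply: product_measure1E => //; exact: measurable_itv.
  rewrite Bb lebesgue_measure_co ?exprS; last by have := ks k; lra.
  by rewrite -EFinM; congr (_%:E); ring.
(* The slabs are disjoint, so at most one term is nonzero. The cutoff at [2 ^+ N' * s] makes the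
   bound vanish on the slab added next. *)
have gF N' x : g N' x <= if `[< B x.1 >] && (s <= x.2 < 2 ^+ N' * s) then c / x.2 else 0.
  elim: N' => [|N' IH].
    rewrite /g big_ord0; case: ifP => // /andP[_ /andP[sx _]].
    by rewrite divr_ge0// (le_trans (ltW s0)).
  rewrite /g big_ord_recr/= -/(g N' x).
  have sN : s <= 2 ^+ N' * s by rewrite ler_pMl// exprn_ege1// ler1n.
  have SN : 2 ^+ N'.+1 * s = 2 * (2 ^+ N' * s) by rewrite exprS mulrA.
  rewrite indicE; move: IH; case: (boolP (x \in W N')) => [/set_mem[/= xB]|xW].
    rewrite in_itv/= => /andP[xl xu].
    have -> : (s <= x.2 < 2 ^+ N' * s) = false by rewrite [X in _ && X]ltNge xl andbF.
    have -> : (s <= x.2 < 2 ^+ N'.+1 * s) = true by rewrite (le_trans sN xl) xu.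
    rewrite (asboolT xB)/= mulr1 => g0.
    apply: (@le_trans _ _ (a N')); first lra.
    apply: ler_wpM2l => //; rewrite lef_pV2 ?posrE//; last exact: lt_le_trans xl.
    exact: ltW.
  rewrite mulr0 addr0 => H; apply: le_trans H _.
  case: asboolP => [xB|_] //=; have [sx|xs] := leP s x.2 => //=.
  case: ltP => xN; first by rewrite ifT//; rewrite SN; have := ks N'; lra.
  by case: ifP => // _; rewrite divr_ge0// (le_trans (ltW s0)).
have mg k : measurable_fun setT (fun x => (a k * \1_(W k) x)%:E).
  by apply/measurable_EFinP; apply: measurable_funM => //; exact: measurable_indic.
have -> : (N%:R * (c * b / 2))%:E = (\int[mu]_x (g N x)%:E)%E.
  rewrite /g; under eq_integral do rewrite -sumEFin.
  rewrite ge0_integral_sum//; last by move=> k x _; rewrite lee_fin mulr_ge0.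
  rewrite (eq_bigr (fun=> (c * b / 2)%:E)) => [|k _].
    by rewrite sumEFin sumr_const card_ord mulr_natl.
  under eq_integral do rewrite EFinM.
  rewrite ge0_integralZl_EFin//; last by apply/measurable_EFinP; exact: measurable_indic.
  rewrite integral_indic// setIT muW -EFinM /a exprS; congr (_%:E).
  have : (2 : R) ^+ k != 0 by rewrite expf_neq0.
  by have : s != 0 by [rewrite gt_eqF]; move: (2 ^+ k) => u s1 u0; field; rewrite u0 s1.
apply: ae_ge0_le_integral => //.
- by move=> x _; rewrite lee_fin; apply: sumr_ge0 => k _; rewrite mulr_ge0.
- rewrite /g; under eq_fun do rewrite -sumEFin.
  exact: emeasurable_sum.
- by move=> x _; rewrite lee_fin.
- exact/measurable_EFinP.
- refine (ae_sub cF _) => x cFx _; rewrite lee_fin; apply: le_trans (gF N x) _.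
  by case: ifP => // /andP[/asboolP xB /andP[sx _]]; exact: cFx.
Qed.

End divergence.

(** * Contradiction with integrability *)

Section main.
Context (R : realType) (n : nat).
Local Notation V := (heis R n.+1).
Local Notation mu := (@hmeasure R n.+1).
Local Notation K := (flag_kernel (@omega R n)).

Lemma measurable_far_base : measurable (@far_base R n).
Proof. exact: measurable_rV_box. Qed.

Lemma lebesgue_far_base : exists2 b : R, 0 < b &
  lebesgue_rV R (n.+1 + n.+1) (@far_base R n) = b%:E.
Proof.
have lohi i : far_lo R i < far_hi R i :> R.
  by rewrite /far_lo /far_hi; case: ifP => _; [lra|case: ifP => _; lra].
exists (\prod_(i < n.+1 + n.+1) (far_hi R i - far_lo R i)).
  by apply: prodr_gt0 => i _; rewrite subr_gt0.
by rewrite lebesgue_rV_box// => i; exact: ltW.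
Qed.

(** The open gap between the two halves of the atom. It contains [far_base], so there the kernel
    hypothesis identifies [T] with the convolution. *)
Definition far_open : set (Cn R n.+1) := [set z | `|z ord0 ord0| < 1].

Lemma open_far_open : open far_open.
Proof.
have c : continuous (fun z : Cn R n.+1 => `|z ord0 ord0|).
  move=> z; apply: (continuous_comp (@coord_continuous R 1 (n.+1 + n.+1) ord0 ord0 z)).
  exact: norm_continuous.
rewrite (_ : far_open = (fun z : Cn R n.+1 => `|z ord0 ord0|) @^-1` [set r | r < 1])//.
by apply: open_comp; [move=> z _; exact: c|exact: open_lt].
Qed.

Lemma atom_far_open (y : V) : far_open y.1 -> atomC y = 0.
Proof.
rewrite /far_open /atomC /= => y1; have [->//|/atom_neq0[]] := eqVneq (atom y) 0.
  move=> [/(_ ord0) y0 _]; exfalso; move: y1 y0.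
  by rewrite /atom_lo /atom_hi eqxx ltr_norml; lra.
move=> [/(_ ord0) y0 _]; exfalso; move: y1 y0.
by rewrite /atom_lo /atom_hi !mxE eqxx ltr_norml/=; lra.
Qed.

(** Boundedness makes the image of the atom integrable, whereas the lower bound c / t forces its
    integral above every multiple of a fixed positive number. *)
Lemma flag_kernel_unbounded (T : (V -> R[i]) -> V -> R[i]) :
  has_kernel T K -> ~ bounded_H1_L1 T.
Proof.
move=> kT [_ [C /(_ _ (@H1_atom R n))[[_ iT] _]]].
have ae : {ae mu, forall x, far_open x.1 -> T (@atomC R n) x = hconv K (@atomC R n) x}.
  apply: kT => //; first exact: H1_atom.
  - exact: open_far_open.
  - by apply: aeW => y; exact: atom_far_open.
have [b b0 bE] := lebesgue_far_base.
have M0 : 0 < 2 * far_scale R n by rewrite mulr_gt0// mulr_gt0// ltr0n.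
pose c := kernel_const R n * atom_mass R n.
have c0 : 0 < c by rewrite mulr_gt0 ?kernel_const_gt0 ?atom_mass_gt0.
pose F (x : V) := `|complex.Im (T (@atomC R n) x)|.
have /integrableP[mT iT'] := iT.
have mF : measurable_fun setT F.
  by apply: measurableT_comp => //; exact/measurable_EFinP.
have F0 x : 0 <= F x by exact: normr_ge0.
have cF : {ae mu, forall x : V, far_base x.1 -> 2 * far_scale R n <= x.2 -> c / x.2 <= F x}.
  refine (ae_sub ae _) => -[v t] /= H vB tM; rewrite /F H.
    apply: le_trans (ler_norm _); exact: Im_hconv_atom_ge.
  have := vB ord0; rewrite /far_open /far_lo /far_hi /= ltr_norml; lra.
have div N := integral_inv_ge N measurable_far_base bE (ltW c0) M0 mF F0 cF.
have : (\int[mu]_x (F x)%:E < +oo)%E by exact: iT'.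
have I0 : (0 <= \int[mu]_x (F x)%:E)%E by apply: integral_ge0 => x _; rewrite lee_fin.
move: I0 div; case: (\int[mu]_x (F x)%:E)%E => [r| |]// r0 div _.
pose d := c * b / 2; have d0 : 0 < d by rewrite divr_gt0// mulr_gt0.
have := div (Num.bound (r / d)); rewrite lee_fin -/d leNgt => /negP; apply.
by rewrite -ltr_pdivrMr//; apply: archi_boundP; rewrite divr_ge0// ltW.
Qed.

End main.

Theorem theorem21 (R : realType) (n : nat) (hn : (0 < n)%N) :
  exists Omega : Cn R n -> R[i],
    [/\ smooth_on_sphere Omega,
        sphere_integral Omega = 0
      & ~ exists T : (heis R n -> R[i]) -> heis R n -> R[i],
            has_kernel T (flag_kernel Omega) /\ bounded_H1_L1 T].
Proof.
(* Positive dimension provides the coordinate z_1. *)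
case: n hn => // n _; exists (@omega R n); split.
- exact: omega_smooth.
- exact: omega_mean0.
- by move=> [T [kT bT]]; exact: flag_kernel_unbounded kT bT.
Qed.
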